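(* Let $s\in\mathbb{N}$, $p\in\{1,\infty\}$, $\frac1p+\frac1{p^*}=1$, and let $\boldsymbol{\gamma}=(\gamma_{\mathfrak{u}})_{\mathfrak{u}\subseteq[s]}$ be arbitrary non-negative weights, not all zero, such that $\gamma_{\mathfrak{w}}>0$ implies $\gamma_{\mathfrak{u}}>0$ for all $\mathfrak{u}\subset\mathfrak{w}$. Let $\mathfrak{U}=\{\mathfrak{u}\subseteq[s]:\gamma_{\mathfrak{u}}>0\}$ and let $\imath:F_{s,p,\boldsymbol{\gamma}}\hookrightarrow H_{s,p,\boldsymbol{\gamma}}$, $\imath(f)=f$, be the embedding of the anchored space into the ANOVA space. Then the lower bound \[ \sup_{\{c_{\mathfrak{u}}\ge0\}_{\mathfrak{u}\in\mathfrak{U}}}\frac{\left(\sum_{\mathfrak{v}\in\mathfrak{U}}\gamma_{\mathfrak{v}}^{-p}\left(\sum_{\mathfrak{w}\subseteq[s]\setminus\mathfrak{v}}c_{\mathfrak{v}\cup\mathfrak{w}}\,\gamma_{\mathfrak{v}\cup\mathfrak{w}}\,m_{p^*}^{|\mathfrak{w}|}\right)^p\right)^{1/p}}{\left(\sum_{\mathfrak{u}\in\mathfrak{U}}c_{\mathfrak{u}}^p\right)^{1/p}},\qquad m_{p^*}=\frac1{(p^*+1)^{1/p^*}},\quad m_\infty=1, \] (supremum over non-negative $c_{\mathfrak{u}}$, not all zero) for $\|\imath\|_{F_{s,p,\boldsymbol{\gamma}}\hookrightarrow H_{s,p,\boldsymbol{\gamma}}}$ is sharp, i.e. it is equal to $\|\imath\|_{F_{s,p,\boldsymbol{\gamma}}\hookrightarrow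 H_{s,p,\boldsymbol{\gamma}}}$.
   Context: Notation: $[s]=\{1,\dots,s\}$, $D=[0,1]$, $D^{\mathfrak{u}}=D^{|\mathfrak{u}|}$ with coordinates indexed by $\mathfrak{u}\subseteq[s]$, $\mathfrak{u}^c=[s]\setminus\mathfrak{u}$, $\boldsymbol{x}_{\mathfrak{u}}=(x_j)_{j\in\mathfrak{u}}$; $[\boldsymbol{x}_{\mathfrak{u}};\boldsymbol{t}_{\mathfrak{u}^c}]$ has entries $x_j$ for $j\in\mathfrak{u}$ and $t_j$ for $j\notin\mathfrak{u}$. $f^{(\mathfrak{u})}=\prod_{j\in\mathfrak{u}}\frac{\partial}{\partial x_j}f$, $f^{(\emptyset)}=f$. $\boldsymbol{1}_I$ is the characteristic function of $I$. All functions are real-valued. $L_p(D^\emptyset)$ is identified with $\mathbb{R}$ with the absolute value as norm. Anchored space: $F_{s,p,\boldsymbol{\gamma}}$ is the space of functions on $D^s$ of the form $f=\sum_{\mathfrak{u}\in\mathfrak{U}}f_{\mathfrak{u}}$ with $f_{\mathfrak{u}}(\boldsymbol{x})=\int_{D^{\mathfrak{u}}}h_{\mathfrak{u}}(\boldsymbol{t}_{\mathfrak{u}})\prod_{j\in\mathfrak{u}}\boldsymbol{1}_{[0,x_j)}(t_j)\,\mathrm{d}\boldsymbol{t}_{\mathfrak{u}}$, $h_{\mathfrak{u}}\in L_p(D^{\mathfrak{u}})$ ($f_\emptyset$ is a constant). This decomposition is unique, $h_{\mathfrak{u}}=f^{(\mathfrak{u})}([\cdot_{\mathfrak{u}};\boldsymbol{0}_{\mathfrak{u}^c}])$,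 and the norm is $\|f\|_{F_{s,p,\boldsymbol{\gamma}}}=\big(\sum_{\mathfrak{u}\in\mathfrak{U}}\gamma_{\mathfrak{u}}^{-p}\|h_{\mathfrak{u}}\|_{L_p(D^{\mathfrak{u}})}^p\big)^{1/p}$. ANOVA space: $H_{s,p,\boldsymbol{\gamma}}$ is the space of functions of the form $f=\sum_{\mathfrak{u}\in\mathfrak{U}}f_{\mathfrak{u}}$ with $f_{\mathfrak{u}}(\boldsymbol{x})=\int_{D^{\mathfrak{u}}}g_{\mathfrak{u}}(\boldsymbol{t}_{\mathfrak{u}})\prod_{j\in\mathfrak{u}}(\boldsymbol{1}_{[0,x_j)}(t_j)-(1-t_j))\,\mathrm{d}\boldsymbol{t}_{\mathfrak{u}}$, $g_{\mathfrak{u}}\in L_p(D^{\mathfrak{u}})$. This decomposition is unique, $g_{\mathfrak{u}}=\int_{D^{\mathfrak{u}^c}}f^{(\mathfrak{u})}([\cdot_{\mathfrak{u}};\boldsymbol{t}_{\mathfrak{u}^c}])\,\mathrm{d}\boldsymbol{t}_{\mathfrak{u}^c}$, and the norm is $\|f\|_{H_{s,p,\boldsymbol{\gamma}}}=\big(\sum_{\mathfrak{u}\in\mathfrak{U}}\gamma_{\mathfrak{u}}^{-p}\|g_{\mathfrak{u}}\|_{L_p(D^{\mathfrak{u}})}^p\big)^{1/p}$. Under the stated condition on the weights the two spaces are equal as sets of functions, so $\imath$ is well defined; $\|\imath\|$ is its operator norm. Conventions: for $p=\infty$ all expressions $(\sum\cdots^p)^{1/p}$ are read as maxima (so the ratio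 is $\max_{\mathfrak{v}\in\mathfrak{U}}\gamma_{\mathfrak{v}}^{-1}\sum_{\mathfrak{w}}c_{\mathfrak{v}\cup\mathfrak{w}}\gamma_{\mathfrak{v}\cup\mathfrak{w}}m_{p^*}^{|\mathfrak{w}|}$ divided by $\max_{\mathfrak{u}}c_{\mathfrak{u}}$). In sums over $\mathfrak{w}\subseteq[s]\setminus\mathfrak{v}$, terms with $\mathfrak{v}\cup\mathfrak{w}\notin\mathfrak{U}$ are zero. *)

(* Defs.v *)
From HB Require Import structures.
From mathcomp Require Export all_boot all_order all_algebra.
From mathcomp Require Export all_classical all_reals all_analysis.
Export numFieldNormedType.Exports.
Export Order.TTheory GRing.Theory Num.Theory.

Set Implicit Arguments.
Unset Strict Implicit.
Unset Printing Implicit Defensive.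

Local Open Scope classical_set_scope.
Local Open Scope ring_scope.

Section cube_measure.
Context {R : realType}.

Definition cube n : set (n.-tuple R) :=
  [set x | forall i, 0 <= tnth x i <= 1].

Definition cons_pair n (xt : measurableTypeR R * n.-tuple R) : n.+1.-tuple R :=
  [tuple of xt.1 :: xt.2].

Lemma measurable_cons_pair n : measurable_fun setT (@cons_pair n).
Proof. exact: measurable_cons. Qed.

HB.instance Definition _ n :=
  isMeasurableFun.Build _ _ _ _ (@cons_pair n) (@measurable_cons_pair n).

(* Lebesgue measure on $[0,1]^n$ as a product measure on n-tuples; the single
   point of the 0-dimensional cube has mass 1. It is concentrated on the cube,
   so integrals and norms need no explicit restriction of the domain. *)
Fixpoint cube_measure (n : nat) : probability (n.-tuple R) R :=
  match n with
  | 0 => \d_([tuple of [::]] : 0.-tuple R)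
  | m.+1 =>
      distribution (uniform_prob (@ltr01 R) \x cube_measure m)%E (@cons_pair m)
  end.

End cube_measure.

(* $(\sum_{u \in U} w_u^{-p} a_u^p)^{1/p}$ for finite p and
   $\max_{u \in U} w_u^{-1} a_u$ for infinite p, where w > 0 and a >= 0 on U. *)
Definition weighted_norm (R : realType) (I : finType) (p : \bar R)
    (U : {set I}) (w a : I -> R) : R :=
  match p with
  | r%:E => (\sum_(u in U) w u `^ (- r) * a u `^ r) `^ r^-1
  | +oo%E => \big[Num.max/0]_(u in U) ((w u)^-1 * a u)
  | -oo%E => 0
  end.

Definition m_const (R : realType) (q : \bar R) : R :=
  match q with
  | r%:E => ((r + 1) `^ r^-1)^-1
  | +oo%E => 1
  | -oo%E => 0
  end.

Section spaces.
Context {R : realType} {s : nat}.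
Implicit Types (p : \bar R) (gamma : {set 'I_s} -> R) (u : {set 'I_s}).
Implicit Types (f : s.-tuple R -> R).

Definition active gamma : {set {set 'I_s}} := [set u | 0 < gamma u]%SET.

(* A point of $D^u$ is a #|u|-tuple, whose coordinate number j belongs to the
   element [enum_val j] of u. *)
Definition kernel_family := forall u, s.-tuple R -> #|u|.-tuple R -> R.

Definition anchored_kernel : kernel_family := fun u x t =>
  \prod_(j < #|u|) \1_(`[0, tnth x (enum_val j)[%classic) (tnth t j).

Definition anova_kernel : kernel_family := fun u x t =>
  \prod_(j < #|u|)
    (\1_(`[0, tnth x (enum_val j)[%classic) (tnth t j) - (1 - tnth t j)).

Definition coef_family := forall u, #|u|.-tuple R -> R.

Definition decomposes (K : kernel_family) p gamma (h : coef_family) f :=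
  (forall u, u \in active gamma -> h u \in Lfun (cube_measure #|u|) p) /\
  (forall x, cube x -> f x =
    \sum_(u in active gamma) \int[cube_measure #|u|]_t (h u t * K u x t)).

(* Functions on $D^s$ are functions on s-tuples of which only the values on the
   cube matter. *)
Definition fspace (K : kernel_family) p gamma : set (s.-tuple R -> R) :=
  [set f | exists h, decomposes K p gamma h f].

Definition coef_norm p gamma (h : coef_family) : R :=
  weighted_norm p (active gamma) gamma
    (fun u => fine ('N[cube_measure #|u|]_p[EFin \o h u])%E).

(* The decomposition of f being unique almost everywhere, the set below has one
   element, the norm of f, when f is in the space. It is empty otherwise, and
   then the value is +oo. *)
Definition fnorm (K : kernel_family) p gamma f : \bar R :=
  xget +oo%E [set (coef_norm p gamma h)%:E | h in decomposes K p gamma ^~ f].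

Definition anchored_space := fspace anchored_kernel.
Definition anchored_norm := fnorm anchored_kernel.
Definition anova_norm := fnorm anova_kernel.

Definition embedding_norm p gamma : \bar R :=
  ereal_sup [set anova_norm p gamma f | f in
    [set f | anchored_space p gamma f /\ (anchored_norm p gamma f <= 1)%E]].

Definition lower_bound_ratio p (q : \bar R) gamma (c : {set 'I_s} -> R) : R :=
  weighted_norm p (active gamma) gamma
    (fun v => \sum_(w : {set 'I_s} |
                    (w \subset ~: v) && (v :|: w \in active gamma))
       c (v :|: w) * gamma (v :|: w) * m_const q ^+ #|w|)
  / weighted_norm p (active gamma) (fun=> 1) c.

End spaces.

(* Main.v *)
Require Import Defs.
From HB Require Import structures.
From mathcomp Require Import measurable_realfun ess_sup_inf ring lra.

(* Writing 1_[0,x)(t) = (1_[0,x)(t) - (1 - t)) + (1 - t) in every factor of the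
   anchored kernel turns an anchored decomposition (h_u) of f into the ANOVA one,
     g_v = sum_(u >= v) \int h_u \prod_(j in u \ v) (1 - t_j) dt_(u \ v).
   The factors 1 - t_j contribute at most m_{p*} each (Hoelder, elementary for p
   in {1, oo}), so |g_v|_p <= sum_(u >= v) |h_u|_p m_{p*}^|u \ v|, and the choice
   c_u = |h_u|_p / gamma_u bounds the embedding norm by the supremum. Conversely,
   given c, take h_u = c_u gamma_u \prod_(j in u) phi(t_j): then g_v is a multiple
   of \prod_(j in v) phi(t_j). For p = oo, phi = 1 makes the inequality an
   equality; for p = 1, phi = a^-1 1_[0,a) does so up to a factor (1 - a)^s, and
   a tends to 0.
   Reading the norm of f from a decomposition needs the uniqueness of both
   decompositions. An anchored one is unique because setting x_j = 0 outside v
   isolates the integrals of h_v over corners [0, x), which determine h_v; an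
   ANOVA one because the inverse triangular transform (with t - 1 in place of
   1 - t) maps it to an anchored one. *)

Set Implicit Arguments.
Unset Strict Implicit.
Unset Printing Implicit Defensive.

Local Open Scope classical_set_scope.
Local Open Scope ring_scope.

(** * Boxes and the cube measure *)

Section boxes.
Context {R : realType}.
Implicit Types n : nat.

Definition box n (A : 'I_n -> set R) : set (n.-tuple R) :=
  [set x | forall i, A i (tnth x i)].

Lemma measurable_box n (A : 'I_n -> set R) :
  (forall i, measurable (A i)) -> measurable (box A).
Proof.
move=> mA; have -> : box A = \bigcap_(i in [set: 'I_n]) ((@tnth _ R)^~ i @^-1` A i).
  by apply/seteqP; split=> x /= h => [i _|i]; exact: h.
apply: fin_bigcap_measurable => // i _; rewrite -[X in measurable X]setTI.
exact: measurable_tnth.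
Qed.

Lemma indic_box n (A : 'I_n -> set R) (x : n.-tuple R) :
  \1_(box A) x = \prod_i \1_(A i) (tnth x i) :> R.
Proof.
have [xA|xA] := boolP (x \in box A).
  rewrite indicE xA big1// => i _; rewrite indicE mem_set//; exact: (set_mem xA).
have /existsNP[i xi] : ~ box A x by move=> ?; move/negP: xA; apply; exact: mem_set.
by rewrite indicE (negbTE xA) (bigD1 i)//= indicE memNset//= mul0r.
Qed.

(** A pi-system that generates the measurable sets and, with integer bounds, exhausts the space; it
    serves both the uniqueness of measures and Dynkin induction. *)
Definition orthants n : set (set (n.-tuple R)) :=
  [set B | exists a : 'I_n -> R, B = box (fun i => `]-oo, a i[%classic)].

Lemma setI_closed_orthants n : setI_closed (@orthants n).
Proof.
move=> _ _ [a ->] [b ->]; exists (fun i => Num.min (a i) (b i)).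
apply/seteqP; split=> x /=.
  move=> [xa xb] i; have := xa i; have := xb i.
  by rewrite /= !in_itv /= lt_min => -> ->.
by move=> h; split => i; have := h i; rewrite /= !in_itv /= lt_min => /andP[].
Qed.

Lemma tuple_lt_natr n (x : n.-tuple R) : exists k, forall i, tnth x i < k%:R.
Proof.
exists (Num.truncn (\big[Num.max/0]_i `|tnth x i|)).+1 => i.
apply: le_lt_trans (truncnS_gt _); rewrite (le_trans (ler_norm _))//.
exact: (le_bigmax _ (fun i => `|tnth x i|)).
Qed.

(** The sets [B] whose preimages under a coordinate lie in the generated sigma-algebra form a
    sigma-algebra themselves, so it suffices that they contain the rays. *)
Lemma measurable_tuple_generated n :
  @measurable _ (n.-tuple R) = <<s @orthants n >>.
Proof.
set G := @orthants n; apply/seteqP; split; last first.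
  apply: smallest_sub; first exact: sigma_algebra_measurable.
  by move=> _ [a ->]; exact: measurable_box.
apply: smallest_sub; first exact: smallest_sigma_algebra.
suff ray (i : 'I_n) (B : set R) : measurable B ->
    <<s G >> ((@tnth _ R)^~ i @^-1` B).
  case: n @G ray => [|n] G ray; first by rewrite big_ord0 => ? [].
  rewrite -bigcup_mkord_ord => _ [k kn [B mB <-]]; rewrite setTI; exact: ray.
move=> mB; have {}mB : <<s @RGenInftyO.G R >> B.
  by have : (@RGenInftyO.G R).-sigma.-measurable B by rewrite -RGenInftyO.measurableE.
pose F := [set B : set R | <<s G >> ((@tnth _ R)^~ i @^-1` B)].
suff : F B by [].
apply: mB; split; first split.
- by rewrite /F /= preimage_set0; exact: sigma_algebra0.
- move=> A; rewrite /F /= => FA; rewrite setTD preimage_setC.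
  rewrite -[X in <<s G >> X]setTD; exact: sigma_algebraCD.
- by move=> A FA; rewrite /F /= preimage_bigcup; exact: sigma_algebra_bigcup.
- move=> _ [a ->]; rewrite /F /=.
  (* A half-space is the union over [k] of the orthants with bound [a] at [i] and [k] at every other
     coordinate. *)
  have -> : (@tnth _ R)^~ i @^-1` `]-oo, a[%classic = \bigcup_k
      box (fun j => `]-oo, (if j == i then a else k%:R)[%classic).
    apply/seteqP; split=> x /=; last by move=> [k _ /(_ i)]; rewrite eqxx.
    rewrite in_itv /= => xa.
    have [k xk] := tuple_lt_natr x; exists k => // j; rewrite /= in_itv /=.
    by case: eqP => [->|].
  apply: sigma_algebra_bigcup => k; apply: sub_sigma_algebra.
  by exists (fun j => if j == i then a else k%:R).
Qed.

(** Finiteness of [m1] on the whole space carries over to the exhausting orthants, so agreement on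
    the pi-system suffices. *)
Lemma tuple_measure_unique n (m1 m2 : {measure set (n.-tuple R) -> \bar R}) :
  (m1 setT < +oo)%E ->
  (forall a : 'I_n -> R,
    m1 (box (fun i => `]-oo, a i[%classic)) = m2 (box (fun i => `]-oo, a i[%classic))) ->
  forall A, measurable A -> m1 A = m2 A.
Proof.
move=> m1fin m12 A mA.
apply: (measure_unique _ (fun k => box (fun _ : 'I_n => `]-oo, (k%:R : R)[%classic))
          (measurable_tuple_generated n)) => //.
- exact: setI_closed_orthants.
- by move=> k; exists (fun=> k%:R).
- apply/seteqP; split=> // x _.
  by have [k xk] := tuple_lt_natr x; exists k => // j; rewrite /= in_itv /=.
- by move=> _ [a ->]; exact: m12.
- move=> k; apply: le_lt_trans m1fin; apply: le_measure => //; rewrite inE //.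
  exact: measurable_box.
Qed.

Local Notation U := (uniform_prob (@ltr01 R)).

(** Induction on [n]: Tonelli on the product measure separates the first coordinate from the
    others. *)
Lemma ge0_integral_cube_measure_prod n (phi : 'I_n -> R -> R) :
  (forall i, measurable_fun setT (phi i)) -> (forall i x, 0 <= phi i x) ->
  (\int[cube_measure n]_x (\prod_i phi i (tnth x i))%:E =
   \prod_i \int[U]_x (phi i x)%:E)%E.
Proof.
elim: n phi => [|n ih] phi mphi phi0.
  under eq_integral do rewrite big_ord0.
  by rewrite integral_cst// big_ord0 mul1e; exact: probability_setT.
have mprod m (psi : 'I_m -> R -> R) : (forall i, measurable_fun setT (psi i)) ->
    measurable_fun setT (fun x : m.-tuple R => (\prod_i psi i (tnth x i))%:E).
  move=> mpsi; apply/measurable_EFinP; apply: measurable_prod => i _.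
  apply: (measurableT_comp (mpsi i)); exact: measurable_tnth.
rewrite /= ge0_integral_distribution//; last 2 first.
- exact: mprod.
- by move=> y; rewrite lee_fin prodr_ge0.
rewrite fubini_tonelli1//; last 2 first.
- by apply: measurableT_comp; [exact: mprod|exact: measurable_cons_pair].
- by move=> y; rewrite lee_fin prodr_ge0.
rewrite [RHS]big_ord_recl /=.
rewrite -(ih (fun i => phi (lift ord0 i)))//.
rewrite -ge0_integralZr//; last 3 first.
- by apply/measurable_EFinP; exact: mphi.
- by move=> x _; rewrite lee_fin.
- by apply: integral_ge0 => x _; rewrite lee_fin prodr_ge0.
apply: eq_integral => x _.
rewrite /fubini_F /= -ge0_integralZl//; last 3 first.
- by apply: (mprod _ (fun i => phi (lift ord0 i))) => i; exact: mphi.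
- by move=> y _; rewrite lee_fin prodr_ge0.
- by rewrite lee_fin.
apply: eq_integral => y _; rewrite big_ord_recl /= -EFinM; congr (_ * _)%:E.
by apply: eq_bigr => i _; rewrite tnthS.
Qed.

Lemma cube_measure_box n (A : 'I_n -> set R) :
  (forall i, measurable (A i)) ->
  cube_measure n (box A) = (\prod_i U (A i))%E.
Proof.
move=> mA.
have := @ge0_integral_cube_measure_prod n (fun i => \1_(A i))
  (fun i => @measurable_indic _ _ R _ _ (mA i)) (fun i x => ler0n _ _).
rewrite (eq_integral (fun x => (\1_(box A) x)%:E)); last first.
  by move=> x _; rewrite indic_box.
rewrite integral_indic//; last exact: measurable_box.
rewrite setIT => ->; apply: eq_bigr => i _.
rewrite integral_indic ?setIT //; exact: mA.
Qed.

End boxes.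

(** * Partial integration *)

Section image_measure.
Context d1 d2 (X : measurableType d1) (Y : measurableType d2) (R : realType).
Variables (mu : {measure set X -> \bar R}) (nu : {measure set Y -> \bar R}).
Variable phi : {mfun X >-> Y}.
Hypothesis nuE : forall A, measurable A -> nu A = mu (phi @^-1` A).
Local Open Scope ereal_scope.
Implicit Types f : Y -> \bar R.

(** Since [nu] is the image of [mu] under [phi], this is a change of variables; [phi] is [merge] or
    [restr] in what follows. *)
Lemma ge0_integral_image f : measurable_fun setT f -> (forall y, 0 <= f y) ->
  \int[nu]_y f y = \int[mu]_x f (phi x).
Proof.
move=> mf f0; rewrite (@eq_measure_integral _ _ _ _ (pushforward mu phi)).
  by rewrite ge0_integral_pushforward// preimage_setT.
by move=> A mA _; exact: nuE.
Qed.

Lemma integrable_image f : nu.-integrable setT f ->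
  mu.-integrable setT (f \o phi).
Proof.
move=> /integrableP[mf fi]; apply/integrableP; split; first exact: measurableT_comp.
rewrite -(ge0_integral_image (f := abse \o f)) => [//||y]; last exact: abse_ge0.
exact: measurableT_comp.
Qed.

Lemma integral_image f : nu.-integrable setT f ->
  \int[nu]_y f y = \int[mu]_x f (phi x).
Proof.
move=> fi; rewrite (@eq_measure_integral _ _ _ _ (pushforward mu phi)).
  rewrite integral_pushforward// ?preimage_setT//.
    exact: (measurable_int nu).
  exact: integrable_image.
by move=> A mA _; exact: nuE.
Qed.

Lemma ae_image (P : Y -> Prop) : {ae nu, forall y, P y} ->
  {ae mu, forall x, P (phi x)}.
Proof.
move=> [N [mN N0 PN]]; exists (phi @^-1` N); split.
- by rewrite -[X in measurable X]setTI; exact: measurable_funP.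
- by rewrite -nuE.
- by move=> x /= Px; exact: PN.
Qed.

End image_measure.

Section merge.
Context {R : realType} {s : nat}.
Implicit Types v : {set 'I_s}.

Definition restr v (y : s.-tuple R) : #|v|.-tuple R :=
  [tuple tnth y (enum_val i) | i < #|v|].

(* The point [t_v; y_(v^c)]: coordinates in v come from t, the others from y. *)
Definition merge v (ty : #|v|.-tuple R * s.-tuple R) : s.-tuple R :=
  [tuple (if [pick i | enum_val i == j] is Some i then tnth ty.1 i
          else tnth ty.2 j) | j < s].

Lemma tnth_restr v y i : tnth (restr v y) i = tnth y (enum_val i).
Proof. by rewrite tnth_mktuple. Qed.

Lemma tnth_merge_in v (t : #|v|.-tuple R) y i :
  tnth (merge (t, y)) (enum_val i) = tnth t i.
Proof.
rewrite tnth_mktuple; case: pickP => [k /eqP/enum_val_inj -> //|/(_ i)].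
by rewrite eqxx.
Qed.

Lemma tnth_merge_out v (t : #|v|.-tuple R) y j : j \notin v ->
  tnth (merge (t, y)) j = tnth y j.
Proof.
move=> jv; rewrite tnth_mktuple; case: pickP => // k /eqP kj.
by move: jv; rewrite -kj enum_valP.
Qed.

Lemma restr_merge v (t : #|v|.-tuple R) y : restr v (merge (t, y)) = t.
Proof. by apply: eq_from_tnth => i; rewrite tnth_restr tnth_merge_in. Qed.

Lemma measurable_restr v : measurable_fun setT (restr v).
Proof.
apply/measurable_fun_tnthP => i.
rewrite (_ : _ \o _ = (@tnth _ R)^~ (enum_val i)); first exact: measurable_tnth.
by apply/funext => y /=; rewrite tnth_restr.
Qed.

Lemma measurable_merge v : measurable_fun setT (@merge v).
Proof.
apply/measurable_fun_tnthP => j; have [jv|jv] := boolP (j \in v).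
  rewrite (_ : _ \o _ = (@tnth _ R)^~ (enum_rank_in jv j) \o fst).
    by apply: measurableT_comp => //; exact: measurable_tnth.
  apply/funext => -[t y] /=.
  by rewrite -[in LHS](enum_rankK_in jv jv) tnth_merge_in.
rewrite (_ : _ \o _ = (@tnth _ R)^~ j \o snd).
  by apply: measurableT_comp => //; exact: measurable_tnth.
by apply/funext => -[t y] /=; rewrite tnth_merge_out.
Qed.

HB.instance Definition _ v :=
  isMeasurableFun.Build _ _ _ _ (restr v) (@measurable_restr v).
HB.instance Definition _ v :=
  isMeasurableFun.Build _ _ _ _ (@merge v) (@measurable_merge v).

Lemma preimage_merge_box v (A : 'I_s -> set R) :
  @merge v @^-1` box A =
  box (fun i => A (enum_val i)) `*` box (fun j => if j \in v then setT else A j).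
Proof.
apply/seteqP; split=> -[t y] /= => [h|[ht hy] j].
  split=> [i|j /=]; first by have := h (enum_val i); rewrite tnth_merge_in.
  by case: ifPn => // jv; have := h j; rewrite tnth_merge_out.
have [jv|jv] := boolP (j \in v).
  by rewrite -(enum_rankK_in jv jv) tnth_merge_in; exact: ht.
by have := hy j; rewrite (negbTE jv) tnth_merge_out.
Qed.

Local Notation mu := (@cube_measure R).

(** Both sides are finite measures of [A], so orthants suffice; there the coordinates of [y] inside
    [v] are unconstrained and contribute the factor 1. *)
Lemma cube_measure_merge v (A : set (s.-tuple R)) : measurable A ->
  mu s A = (mu #|v| \x mu s)%E (@merge v @^-1` A).
Proof.
apply: (@tuple_measure_unique _ _ _ (pushforward (mu #|v| \x mu s)%E (@merge v))).
  by apply: (@le_lt_trans _ _ 1%E); [exact: probability_le1|exact: ltry].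
move=> a; transitivity ((mu #|v| \x mu s)%E
    (@merge v @^-1` box (fun i => `]-oo, a i[%classic))); last by [].
rewrite preimage_merge_box product_measure1E; last 2 first.
- exact: measurable_box.
- by apply: measurable_box => j; case: ifP.
rewrite [LHS]cube_measure_box// [X in (X * _)%E]cube_measure_box//.
rewrite [X in (_ * X)%E]cube_measure_box; last by move=> j; case: ifP.
rewrite -(big_enum_val (fun j => uniform_prob (@ltr01 R) `]-oo, a j[%classic)).
rewrite (bigID (mem v)) /=; congr (_ * _)%E.
rewrite [RHS](bigID (mem v)) /= [X in _ = (X * _)%E]big1 ?mul1e; last first.
  by move=> j ->; exact: probability_setT.
by apply: eq_bigr => j /negbTE ->.
Qed.

(** Merging [t] with any [y] keeps [t] as the restriction to [v], so the preimage in the product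
    space is a cylinder over [A]. *)
Lemma cube_measure_restr v (A : set (#|v|.-tuple R)) : measurable A ->
  mu #|v| A = mu s (restr v @^-1` A).
Proof.
move=> mA; rewrite (@cube_measure_merge v); last first.
  by rewrite -[X in measurable X]setTI; exact: measurable_funP.
rewrite (_ : _ @^-1` _ = A `*` setT); last first.
  by apply/seteqP; split=> -[t y] /=; rewrite restr_merge// => -[].
rewrite product_measure1E// [X in (_ * X)%E](_ : _ = 1%E) ?mule1//.
exact: probability_setT.
Qed.

End merge.

Lemma ae_eq_integrable d (T : measurableType d) (R : realType)
    (mu : {measure set T -> \bar R}) (f g : T -> \bar R) :
  measurable_fun setT g -> ae_eq mu setT f g ->
  mu.-integrable setT f -> mu.-integrable setT g.
Proof.
move=> mg fg /integrableP[mf fi]; apply/integrableP; split => //.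
rewrite (@ae_eq_integral _ _ _ mu setT (abse \o f)) => //.
- exact: measurableT_comp.
- exact: measurableT_comp.
- by apply: filterS fg => x /= /(_ I) ->.
Qed.

Lemma abse_fine_le (R : realType) (x : \bar R) : (`|(fine x)%:E| <= `|x|)%E.
Proof. by case: x => [r| |] //=; rewrite normr0 leey. Qed.

Section average.
Context {R : realType} {s : nat}.
Implicit Types (v : {set 'I_s}) (G : s.-tuple R -> R).
Local Notation mu := (@cube_measure R).

(* Integrates out the coordinates outside v. Averaging over all s coordinates of y
   is harmless since those in v are overwritten by t. *)
Definition avg v G (t : #|v|.-tuple R) : R := \int[mu s]_y G (merge (t, y)).

(** The partial integral with extended real values. Where it is infinite, [avg] takes the default
    value 0; for integrable [G] this happens on a null set only. *)
Let fub v G (t : #|v|.-tuple R) : \bar R :=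
  fubini_F (mu s) ((EFin \o G) \o @merge R s v) t.

Let avgE v G : avg G = fine \o fub G :> (#|v|.-tuple R -> R).
Proof. by []. Qed.

Let integrable_comp_merge v G :
  (mu s).-integrable setT (EFin \o G) ->
  (mu #|v| \x mu s)%E.-integrable setT ((EFin \o G) \o @merge R s v).
Proof. by apply: integrable_image => A mA; exact: cube_measure_merge. Qed.

Lemma measurable_avg v G : (mu s).-integrable setT (EFin \o G) ->
  measurable_fun setT (@avg v G).
Proof.
move=> iG; rewrite avgE; apply: measurableT_comp => //.
exact/measurable_fubini_F/integrable_comp_merge.
Qed.

Lemma integrable_avg v G : (mu s).-integrable setT (EFin \o G) ->
  (mu #|v|).-integrable setT (EFin \o @avg v G).
Proof.
move=> iG; have iF := integrable_fubini_F (@integrable_comp_merge v G iG).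
apply: (le_integrable _ _ _ iF) => //.
  by apply/measurable_EFinP; exact: measurable_avg.
by move=> t _; exact: abse_fine_le.
Qed.

Lemma Rintegral_avg v G : (mu s).-integrable setT (EFin \o G) ->
  \int[mu #|v|]_t avg G t = \int[mu s]_y G y.
Proof.
move=> iG; have iF := integrable_fubini_F (@integrable_comp_merge v G iG).
rewrite /Rintegral; congr fine; transitivity (\int[mu #|v|]_t fub G t)%E.
  apply: ae_eq_integral => //.
  - by apply/measurable_EFinP; exact: measurable_avg.
  - exact: measurable_int iF.
  - apply: filterS (integrable_ae measurableT iF) => t h /h; exact: fineK.
rewrite [LHS]integral12_prod_meas1; last exact: integrable_comp_merge.
by apply/esym/integral_image => // A mA; exact: cube_measure_merge.
Qed.

(** The triangle inequality in the inner integral and Tonelli outside make averaging a contraction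
    of L_1. *)
Lemma integral_norm_avg_le v G : (mu s).-integrable setT (EFin \o G) ->
  (\int[mu #|v|]_t `|avg G t|%:E <= \int[mu s]_y `|G y|%:E)%E.
Proof.
move=> iG; have mG := measurable_int _ iG.
have mnG : measurable_fun setT (abse \o (EFin \o G)) by exact: measurableT_comp.
have mnGm : measurable_fun setT ((abse \o (EFin \o G)) \o @merge R s v).
  exact: (measurableT_comp mnG (@measurable_merge R s v)).
have -> : (\int[mu s]_y `|G y|%:E = \int[mu #|v|]_t \int[mu s]_y
    ((abse \o (EFin \o G)) \o @merge R s v) (t, y))%E.
  rewrite -(fubini_tonelli1 ((abse \o (EFin \o G)) \o @merge R s v))//; last first.
    by move=> ty; exact: abse_ge0.
  apply: (@ge0_integral_image _ _ _ _ _ _ _ (@merge R s v) _ (abse \o (EFin \o G))) => //.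
    by move=> A mA; exact: cube_measure_merge.
  by move=> y; exact: abse_ge0.
apply: ge0_le_integral => //.
- by apply/measurable_EFinP; apply: measurableT_comp => //; exact: measurable_avg.
- apply: (measurable_fun_fubini_tonelli_F ((abse \o (EFin \o G)) \o @merge R s v)) => //.
  by move=> ty; exact: abse_ge0.
- move=> t _; apply: (@le_trans _ _ `|fub G t|%E).
    exact: abse_fine_le.
  apply: le_abse_integral => //; apply: measurableT_comp => //=.
  by apply: measurableT_comp => //; exact: pair1_measurable.
Qed.

(** The factor [k t] can be pulled out wherever the slice of [G] at [t] is integrable, that is, for
    almost every [t]. *)
Lemma ae_avgM v (k : #|v|.-tuple R -> R) G :
  (mu s).-integrable setT (EFin \o G) ->
  {ae mu #|v|, forall t, avg (fun y => k (restr v y) * G y) t = k t * avg G t}.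
Proof.
move=> iG; apply: filterS (ae_integrable1 (@integrable_comp_merge v G iG)) => t it.
by rewrite /avg -RintegralZl//; apply: eq_Rintegral => y _; rewrite restr_merge.
Qed.

Lemma avg_restr v (k : #|v|.-tuple R -> R) t : avg (fun y => k (restr v y)) t = k t.
Proof.
rewrite /avg; under eq_Rintegral do rewrite restr_merge.
rewrite Rintegral_cst// [X in fine X](_ : _ = 1%E) ?mulr1//.
exact: probability_setT.
Qed.

(** Averaging is adjoint to composition with [restr], like a conditional expectation. As [k] may be
    unbounded, integrability of the product is a hypothesis. *)
Lemma Rintegral_avgM v (k : #|v|.-tuple R -> R) G :
  measurable_fun setT k ->
  (mu s).-integrable setT (EFin \o G) ->
  (mu s).-integrable setT (EFin \o (fun y => k (restr v y) * G y)) ->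
  (mu #|v|).-integrable setT (EFin \o (fun t => k t * avg G t)) /\
  \int[mu #|v|]_t (k t * avg G t) = \int[mu s]_y (k (restr v y) * G y).
Proof.
move=> mk iG ikG; have iakG := @integrable_avg v _ ikG.
have mkG : measurable_fun setT (EFin \o (fun t => k t * avg G t)).
  by apply/measurable_EFinP; apply: measurable_funM => //; exact: measurable_avg.
have ae : ae_eq (mu #|v|) setT (EFin \o @avg v (fun y => k (restr v y) * G y))
    (EFin \o (fun t => k t * avg G t)).
  by apply: filterS (ae_avgM k iG) => t /= ->.
split.
  exact: (ae_eq_integrable mkG ae iakG).
rewrite -(Rintegral_avg v ikG) /Rintegral; congr fine; apply: ae_eq_integral => //.
  exact: measurable_int iakG.
exact: ae_eq_sym.
Qed.

Lemma integrable_restr v (h : #|v|.-tuple R -> R) :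
  (mu #|v|).-integrable setT (EFin \o h) ->
  (mu s).-integrable setT (EFin \o (h \o restr v)).
Proof.
by apply: integrable_image => A mA; exact: cube_measure_restr.
Qed.

Lemma Rintegral_restr v (h : #|v|.-tuple R -> R) :
  (mu #|v|).-integrable setT (EFin \o h) ->
  \int[mu #|v|]_t h t = \int[mu s]_y h (restr v y).
Proof.
move=> ih; rewrite /Rintegral; congr fine; apply: integral_image => // A mA.
exact: cube_measure_restr.
Qed.

End average.

Section cube_almost_everywhere.
Context {R : realType}.
Local Notation mu := (@cube_measure R).
Local Notation U := (uniform_prob (@ltr01 R)).

Lemma uniform_prob01E (A : set R) : measurable A ->
  U A = lebesgue_measure (A `&` `[0, 1]%classic).
Proof.
move=> mA; rewrite -(setIT A) -integral_indic// integral_uniform//; last first.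
  exact/measurable_EFinP/measurable_indic.
by rewrite subr0 invr1 mul1e integral_indic// setIT.
Qed.

(** Half-open intervals are chosen so that the indicator of [0,1) equals 1 at almost every
    coordinate. *)
Lemma ae_cube_measure n :
  {ae mu n, forall y : n.-tuple R, forall i, 0 <= tnth y i < 1}.
Proof.
exists (~` box (fun=> `[0, 1[%classic)); split.
- by apply: measurableC; exact: measurable_box.
- rewrite probability_setC; last exact: measurable_box.
  rewrite [X in (_ - X)%E]cube_measure_box// [X in (_ - X)%E]big1 ?subee//.
  move=> i _; rewrite uniform_prob01E// setIidl.
    by rewrite lebesgue_measure_itv/= lte01 oppr0 adde0.
  by apply: subset_itvl; rewrite bnd_simp.
- move=> y /= ny yb; apply: ny => i; by have := yb i; rewrite /= in_itv.
Qed.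

Lemma ae_cube n : {ae mu n, forall y, cube y}.
Proof.
by apply: filterS (ae_cube_measure n) => y h i; have /andP[-> /ltW ->] := h i.
Qed.

Lemma integrable_mul_bounded n (f g : n.-tuple R -> R) (C : R) :
  (mu n).-integrable setT (EFin \o f) -> measurable_fun setT g ->
  (forall y, cube y -> `|g y| <= C) ->
  (mu n).-integrable setT (EFin \o (fun y => f y * g y)).
Proof.
move=> iF mg gC; have /measurable_EFinP mf := measurable_int _ iF.
(* The bound on [g] is known on the cube only; truncation at [-C] and [C] changes [g] on a null set
   and makes the bound global. *)
pose g' y := Num.max (- C) (Num.min C (g y)).
have mg' : measurable_fun setT g'.
  by apply: measurable_maxr => //; exact: measurable_minr.
apply: (@ae_eq_integrable _ _ _ _ (EFin \o (fun y => f y * g' y))).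
- by apply/measurable_EFinP; exact: measurable_funM.
- apply: filterS (ae_cube n) => y cy _ /=; congr (_ * _)%:E.
  have := gC _ cy; rewrite ler_norml => /andP[? ?]; rewrite /g'.
  by rewrite min_r// max_r.
(* [|C|] dominates the truncated factor whatever the sign of [C]. *)
- have iC : (mu n).-integrable setT (fun y => (`|C|%:E * (f y)%:E)%E).
    exact: integrableZl.
  apply: le_integrable iC => //.
    by apply/measurable_EFinP; exact: measurable_funM.
  move=> y _ /=; rewrite lee_fin !normrM mulrC ler_wpM2r// normr_id.
  rewrite ler_norml /g' le_max ge_max ge_min !lerN2.
  case: (lerP 0 C) => C0; rewrite ?(ger0_norm C0) ?(ltr0_norm C0)// ?lexx //;
    apply/andP; split; lra.
Qed.

End cube_almost_everywhere.

(** * Change of kernel *)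

Lemma prodrD_subset (R : comRingType) (I : finType) (u : {set I}) (a b : I -> R) :
  \prod_(j in u) (a j + b j) =
  \sum_(v : {set I} | v \subset u) (\prod_(j in v) a j) * \prod_(j in u :\: v) b j.
Proof.
rewrite big_mkcond.
(* Extending the factors by [0 + 1] outside [u] gives a product over the whole type, in whose
   expansion every [v] not contained in [u] contributes 0. *)
under eq_bigr => j _.
  rewrite (_ : (if _ then _ else _) =
    (if j \in u then a j else 0) + (if j \in u then b j else 1)); last first.
    by case: ifP; rewrite ?add0r.
  over.
rewrite bigA_distr [RHS]big_mkcond; apply: eq_bigr => v _.
case: ifPn => [vu|/fintype.subsetPn[j jv ju]]; last first.
  by rewrite (bigD1 j)//= jv (negbTE ju) mul0r.
rewrite (bigID (mem v)) /=; congr (_ * _).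
  by apply: eq_bigr => j jv; rewrite jv (fintype.subsetP vu).
rewrite big_mkcond [RHS]big_mkcond /=; apply: eq_bigr => j _.
by rewrite inE; case: (j \in v) => //=.
Qed.

Lemma integrable_sumr d (T : measurableType d) (R : realType)
    (mu : {measure set T -> \bar R}) (I : Type) (r : seq I) (P : pred I)
    (F : I -> T -> R) :
  (forall i, P i -> mu.-integrable setT (EFin \o F i)) ->
  mu.-integrable setT (EFin \o (fun x => \sum_(i <- r | P i) F i x)).
Proof.
move=> iF; rewrite (_ : _ \o _ = fun x => \sum_(i <- r | P i) (F i x)%:E)%E.
  by apply: integrable_sum => // i Pi; exact: iF.
by apply/funext => x /=; rewrite sumEFin.
Qed.

Lemma Rintegral_sum d (T : measurableType d) (R : realType)
    (mu : {measure set T -> \bar R}) (I : Type) (r : seq I) (P : pred I)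
    (F : I -> T -> R) :
  (forall i, P i -> mu.-integrable setT (EFin \o F i)) ->
  \int[mu]_x (\sum_(i <- r | P i) F i x) = \sum_(i <- r | P i) \int[mu]_x F i x.
Proof.
move=> iF; elim: r => [|i r ih].
  rewrite big_nil; under eq_Rintegral do rewrite big_nil.
  by rewrite /Rintegral integral0.
rewrite big_cons; under eq_Rintegral do rewrite big_cons.
case: ifP => // Pi; rewrite RintegralD ?ih//; first exact: iF.
exact: integrable_sumr.
Qed.

Section transform.
Context {R : realType} {s : nat}.
Implicit Types (u v : {set 'I_s}) (k : R -> R -> R) (f : R -> R).
Local Notation mu := (@cube_measure R).

(** Shared by the factors of both kernels and by both choices of [sigma]; products of such functions
    stay bounded by 1 on the cube, which keeps the integrands below integrable. *)
Definition unit_bounded f :=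
  measurable_fun setT f /\ forall t, 0 <= t <= 1 -> `|f t| <= 1.

(** Both kernels are instances, with [anchored1] and [anova1] as [k], so one change of kernel covers
    both directions. *)
Definition prod_kernel k : @kernel_family R s := fun u x t =>
  \prod_(j < #|u|) k (tnth x (enum_val j)) (tnth t j).

Lemma prod_kernel_restr k u x y :
  prod_kernel k x (restr u y) = \prod_(j in u) k (tnth x j) (tnth y j).
Proof.
rewrite [RHS]big_enum_val; apply: eq_bigr => j _; by rewrite tnth_restr.
Qed.

Lemma measurable_prod_tnth n (P : pred 'I_n) (phi : 'I_n -> R -> R) :
  (forall i, P i -> measurable_fun setT (phi i)) ->
  measurable_fun setT (fun y : n.-tuple R => \prod_(i | P i) phi i (tnth y i)).
Proof.
move=> mphi; rewrite (_ : (fun _ => _) =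
  fun y : n.-tuple R => \prod_i (if P i then phi i (tnth y i) else 1)).
  apply: measurable_prod => i _; case: (boolP (P i)) => Pi //.
  by apply: (measurableT_comp (mphi i Pi)); exact: measurable_tnth.
by apply/funext => y; rewrite big_mkcond.
Qed.

Lemma prod_tnth_le1 n (P : pred 'I_n) (phi : 'I_n -> R -> R) y :
  (forall i, P i -> unit_bounded (phi i)) -> cube y ->
  `|\prod_(i | P i) phi i (tnth y i)| <= 1.
Proof.
move=> hphi cy; rewrite normr_prod; apply: prodr_ile1 => i Pi.
by rewrite normr_ge0 /=; apply: (hphi i Pi).2; exact: cy.
Qed.

Lemma integrable_mul_prod n (h : n.-tuple R -> R) (P : pred 'I_n)
    (phi : 'I_n -> R -> R) :
  (forall i, P i -> unit_bounded (phi i)) ->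
  (mu n).-integrable setT (EFin \o h) ->
  (mu n).-integrable setT
    (EFin \o (fun y => h y * \prod_(i | P i) phi i (tnth y i))).
Proof.
move=> hphi ih; apply: (@integrable_mul_bounded _ _ _ _ 1) => //.
  by apply: measurable_prod_tnth => i /hphi[].
by move=> y cy; exact: prod_tnth_le1.
Qed.

(* With sigma t = 1 - t, the map from the anchored coefficients to the ANOVA ones;
   with sigma t = t - 1, its inverse. *)
Definition transform (sigma : R -> R) (W : {set {set 'I_s}})
    (h : @coef_family R s) : @coef_family R s := fun v t =>
  \sum_(u in W | v \subset u)
    avg (fun y => h u (restr u y) * \prod_(j in u :\: v) sigma (tnth y j)) t.

Arguments transform sigma W h u _ : clear implicits.

Lemma integrable_transform_term sigma u v (h : #|u|.-tuple R -> R) :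
  unit_bounded sigma -> (mu #|u|).-integrable setT (EFin \o h) ->
  (mu s).-integrable setT
    (EFin \o (fun y => h (restr u y) * \prod_(j in u :\: v) sigma (tnth y j))).
Proof.
move=> bsigma ih.
apply: (@integrable_mul_prod s (h \o restr u) (mem (u :\: v)) (fun=> sigma)) => //.
exact: integrable_restr.
Qed.

Lemma integrable_transform sigma (W : {set {set 'I_s}}) h v :
  unit_bounded sigma ->
  (forall u, u \in W -> (mu #|u|).-integrable setT (EFin \o h u)) ->
  (mu #|v|).-integrable setT (EFin \o transform sigma W h v).
Proof.
move=> bsigma ih; apply: integrable_sumr => u /andP[uW vu].
apply: integrable_avg; apply: integrable_transform_term => //; exact: ih.
Qed.

(** Every factor is split as [(k - sigma) + sigma] and the product is expanded over [v \subset u].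
    After exchanging the sums, the coordinates outside [v] are integrated out, which leaves the
    transformed coefficient against the new kernel. *)
Lemma transform_sum sigma k (W : {set {set 'I_s}}) h (x : s.-tuple R) :
  unit_bounded sigma ->
  (forall z, 0 <= z <= 1 -> unit_bounded (k z)) ->
  (forall z, 0 <= z <= 1 -> unit_bounded (fun t => k z t - sigma t)) ->
  (forall u v, u \subset v -> v \in W -> u \in W) ->
  (forall u, u \in W -> (mu #|u|).-integrable setT (EFin \o h u)) ->
  cube x ->
  \sum_(u in W) \int[mu #|u|]_t (h u t * prod_kernel k x t) =
  \sum_(v in W) \int[mu #|v|]_t
    (transform sigma W h v t * prod_kernel (fun z t => k z t - sigma t) x t).
Proof.
move=> bsigma bk0 bk Wdown ih cx; set k' := fun z t => k z t - sigma t.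
have k'b (i : 'I_s) : unit_bounded (k' (tnth x i)) by exact: bk.
have mK' v : measurable_fun setT (@prod_kernel k' v x).
  apply: (@measurable_prod_tnth _ predT (fun i => k' (tnth x (@enum_val _ (mem v) i)))).
  by move=> i _; have [] := k'b (enum_val i).
have iterm u v : u \in W -> (mu s).-integrable setT (EFin \o (fun y =>
    h u (restr u y) * \prod_(j in u :\: v) sigma (tnth y j))).
  by move=> uW; apply: integrable_transform_term => //; exact: ih.
have iterm' u v : u \in W -> (mu s).-integrable setT (EFin \o (fun y =>
    prod_kernel k' x (restr v y) *
    (h u (restr u y) * \prod_(j in u :\: v) sigma (tnth y j)))).
  move=> uW; rewrite (_ : _ \o _ = EFin \o (fun y =>
    (h u (restr u y) * \prod_(j in u :\: v) sigma (tnth y j)) *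
    \prod_(j in v) k' (tnth x j) (tnth y j))); last first.
    by apply/funext => y /=; rewrite mulrC prod_kernel_restr.
  apply: (@integrable_mul_prod s _ (mem v) (fun j => k' (tnth x j))) => //.
  exact: iterm.
transitivity (\sum_(u in W) \sum_(v : {set 'I_s} | v \subset u) \int[mu s]_y
    (prod_kernel k' x (restr v y) *
    (h u (restr u y) * \prod_(j in u :\: v) sigma (tnth y j)))).
  apply: eq_bigr => u uW; rewrite Rintegral_restr; last first.
    apply: (@integrable_mul_prod _ (h u) predT
      (fun i => k (tnth x (@enum_val _ (mem u) i)))) => [i _|]; last exact: ih.
    by apply: bk0; exact: cx.
  rewrite -Rintegral_sum; last by move=> v _; exact: iterm'.
  apply: eq_Rintegral => y _; rewrite prod_kernel_restr.
  rewrite (eq_bigr (fun j => k' (tnth x j) (tnth y j) + sigma (tnth y j))); last first.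
    by move=> j _; rewrite subrK.
  rewrite prodrD_subset mulr_sumr; apply: eq_bigr => v vu.
  by rewrite prod_kernel_restr mulrCA.
(* Downward closure puts every [v] below a member of [W] into [W], so the new outer sum runs over
   [W]. *)
rewrite (exchange_big_dep (mem W)) /=; last by move=> u v uW vu; exact: Wdown vu uW.
apply: eq_bigr => v vW.
under [RHS]eq_Rintegral do rewrite mulr_suml.
rewrite Rintegral_sum; last first.
  move=> u /andP[uW vu].
  under eq_fun do rewrite mulrC.
  exact: (Rintegral_avgM (mK' v) (iterm u v uW) (iterm' u v uW)).1.
apply: eq_bigr => u /andP[uW vu].
under [RHS]eq_Rintegral do rewrite mulrC.
by rewrite (Rintegral_avgM (mK' v) (iterm u v uW) (iterm' u v uW)).2.
Qed.

End transform.
Arguments transform {R s} sigma W h u _.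

(** * Uniqueness of the decompositions *)

Lemma ae_sum0 d (T : measurableType d) (R : realType)
    (mu : {measure set T -> \bar R}) (I : Type) (r : seq I) (P : pred I)
    (F : I -> T -> R) :
  (forall i, P i -> {ae mu, forall x, F i x = 0}) ->
  {ae mu, forall x, \sum_(i <- r | P i) F i x = 0}.
Proof.
move=> F0; elim: r => [|i r ih]; first by apply: nearW => x; rewrite big_nil.
case: (boolP (P i)) => Pi; last first.
  by apply: filterS ih => x; rewrite big_cons (negbTE Pi).
apply: filterS2 (F0 i Pi) ih => x Fx sx.
by rewrite big_cons Pi Fx sx addr0.
Qed.

Section uniqueness.
Context {R : realType}.
Local Notation mu := (@cube_measure R).

(** The sets over which [h] integrates to 0 form a Dynkin class containing the orthants, hence
    contain all measurable sets, and [h] vanishes almost everywhere. *)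
Lemma ae_eq0_of_corner_integrals n (h : n.-tuple R -> R) :
  (mu n).-integrable setT (EFin \o h) ->
  (forall a : 'I_n -> R, (forall i, 0 <= a i <= 1) ->
    \int[mu n]_t (h t * \prod_i \1_(`[0, a i[%classic) (tnth t i)) = 0) ->
  {ae mu n, forall t, h t = 0}.
Proof.
move=> ih h0.
have mh := measurable_int _ ih.
have mind (a : R) : unit_bounded (\1_(`[0, a[%classic) : R -> R).
  by split=> // t _; rewrite ger0_norm// indicE; case: (_ \in _).
have int0 (a : 'I_n -> R) (A : set (n.-tuple R)) : measurable A ->
    (forall i, 0 <= a i <= 1) ->
    {ae mu n, forall t, \1_A t = \prod_i \1_(`[0, a i[%classic) (tnth t i) :> R} ->
    (\int[mu n]_(t in A) (h t)%:E = 0)%E.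
  move=> mA a01 Aa; rewrite integral_mkcond.
  have iha : (mu n).-integrable setT
      (EFin \o (fun t => h t * \prod_i \1_(`[0, a i[%classic) (tnth t i))).
    by apply: (@integrable_mul_prod _ _ h predT (fun i => \1_(`[0, a i[%classic))).
  rewrite (ae_eq_integral
    (EFin \o (fun t => h t * \prod_i \1_(`[0, a i[%classic) (tnth t i)))) //.
  - rewrite -[LHS]fineK; last exact: integrable_fin_num.
    by congr EFin; exact: h0.
  - by apply/(measurable_restrictT _ mA)/measurable_funTS.
  - exact: measurable_int iha.
  - apply: filterS Aa => t At _; rewrite /= -At restrict_EFin /= patchE indicE.
    by case: (_ \in _); rewrite ?mulr1 ?mulr0.
(* The corner with all bounds equal to 1 is the whole space up to a null set. *)
have intT : (\int[mu n]_(t in setT) (h t)%:E = 0)%E.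
  apply: (int0 (fun=> 1)) => // [i|]; first by rewrite ler01 lexx.
  apply: filterS (ae_cube_measure n) => t ht; rewrite indicT big1// => i _.
  by rewrite indicE mem_set//= in_itv /= ht.
have all0 A : measurable A -> (\int[mu n]_(t in A) (h t)%:E = 0)%E.
  rewrite measurable_tuple_generated; move: A; apply: (@dynkin_induction _ (n.-tuple R) _
    (fun A => \int[mu n]_(t in A) (h t)%:E = 0)%E (measurable_tuple_generated n)) => //.
  - exact: setI_closed_orthants.
  (* Up to a null set an orthant is the corner whose bounds are clamped to [0,1]. *)
  - move=> _ [a ->]; apply: (int0 (fun i => Num.max 0 (Num.min 1 (a i)))).
    + exact: measurable_box.
    + by move=> i; rewrite le_max lexx /= ge_max ler01 ge_min lexx.
    + apply: filterS (ae_cube_measure n) => t ht.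
      have E i : \1_(`[0, Num.max 0 (Num.min 1 (a i))[%classic) (tnth t i) =
          \1_(`]-oo, a i[%classic) (tnth t i) :> R.
        rewrite !indicE !mem_setE !in_itv /=; have /andP[t0 t1] := ht i.
        by rewrite t0 /= lt_max lt_min t1 ltNge t0.
      by rewrite indic_box; apply: eq_bigr => i _; rewrite E.
  - move=> A mA A0.
    have := intT; rewrite -(setvU A) integral_setU_EFin //=.
    + by rewrite A0 addr0.
    + exact: measurableC.
    + by apply/measurable_EFinP; rewrite setvU.
    + by rewrite disj_set2E setICl.
  - move=> F mF tF F0; rewrite integral_bigcup//; last first.
      by apply: integrableS ih => //; exact: bigcup_measurable.
    by rewrite eseries0.
have := @integral_ae_eq _ _ _ (mu n) setT measurableT (cst 0%E) (EFin \o h) ih _ _.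
move=> /(_ (measurable_cst _)) H.
have : ae_eq (mu n) setT (EFin \o h) (cst 0%E).
  by apply: H => E _ mE; rewrite all0// integral0.
by apply: filterS => t /(_ I) [].
Qed.

End uniqueness.

Section coef_uniqueness.
Context {R : realType} {s : nat}.
Implicit Types (u v : {set 'I_s}) (W : {set {set 'I_s}}).
Local Notation mu := (@cube_measure R).

Definition anchored1 (x t : R) : R := \1_(`[0, x[%classic) t.
Definition anova1 (x t : R) : R := \1_(`[0, x[%classic) t - (1 - t).

Lemma anchored1_bounded z : unit_bounded (anchored1 z).
Proof.
split; first exact: measurable_indic.
move=> t _; rewrite /anchored1.
by rewrite ger0_norm// indicE; case: (_ \in _).
Qed.

Lemma onem_bounded : unit_bounded (fun t : R => 1 - t).
Proof.
split; first exact: measurable_funB.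
by move=> t /andP[t0 t1]; rewrite ler_norml; apply/andP; split; lra.
Qed.

Lemma anova1_bounded z : unit_bounded (anova1 z).
Proof.
rewrite /anova1; split.
  by apply: measurable_funB => //; have [] := onem_bounded.
move=> t /andP[t0 t1]; rewrite indicE ler_norml.
by case: (_ \in _) => /=; apply/andP; split; lra.
Qed.

(** Strong induction on the size of [v]: zero coordinates outside [v] remove every [u] not contained
    in [v], and the proper subsets of [v] vanish by induction. *)
Lemma anchored_coef_eq0 W (d : @coef_family R s) :
  (forall u v, u \subset v -> v \in W -> u \in W) ->
  (forall u, u \in W -> (mu #|u|).-integrable setT (EFin \o d u)) ->
  (forall x, cube x ->
    \sum_(u in W) \int[mu #|u|]_t (d u t * anchored_kernel x t) = 0) ->
  forall u, u \in W -> {ae mu #|u|, forall t, d u t = 0}.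
Proof.
move=> Wdown id d0.
have int0 v x : v \in W -> cube x ->
    \int[mu #|v|]_t (d v t * anchored_kernel x t) = 0.
  have [m] := ubnP #|v|; elim: m v x => // m ih v x vm vW cx.
  pose x' : s.-tuple R := [tuple (if j \in v then tnth x j else 0) | j < s].
  have cx' : cube x'.
    by move=> j; rewrite tnth_mktuple; case: ifP => // _; rewrite lexx ler01.
  have /esym := d0 x' cx'; rewrite (bigD1 v)//= [X in _ + X]big1 ?addr0; last first.
    move=> u /andP[uW uv]; have [usv|/fintype.subsetPn[j ju jv]] := boolP (u \subset v).
      apply: ih => //; rewrite -ltnS (leq_trans _ vm)// ltnS.
      by apply: proper_card; rewrite finset.properEneq uv.
    rewrite (_ : (fun _ => _) = cst 0) ?Rintegral_cst ?mul0r//.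
    apply/funext => t /=; rewrite /anchored_kernel (bigD1 (enum_rank_in ju j))//=.
    by rewrite enum_rankK_in// tnth_mktuple (negbTE jv) set_itvco0 indic0 mul0r mulr0.
  move=> ->; apply: eq_Rintegral => t _; congr (_ * _).
  by apply: eq_bigr => i _; rewrite tnth_mktuple enum_valP.
move=> u uW; apply: ae_eq0_of_corner_integrals; first exact: id.
(* The bounds [a] on [u] are completed by the anchor 0 to a point of the cube. *)
move=> a a01; pose x := merge ([tuple a i | i < #|u|], [tuple 0 | j < s]).
rewrite -[RHS](int0 u x)//.
  apply: eq_Rintegral => t _; congr (_ * _); apply: eq_bigr => i _.
  by rewrite tnth_merge_in tnth_mktuple.
move=> j; have [ju|ju] := boolP (j \in u).
  by rewrite -(enum_rankK_in ju ju) tnth_merge_in tnth_mktuple.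
by rewrite tnth_merge_out// tnth_mktuple lexx ler01.
Qed.

(** By the L_1 contraction the average has norm 0; no argument on slices of null sets is
    involved. *)
Lemma ae_avg_eq0 v (G : s.-tuple R -> R) : measurable_fun setT G ->
  {ae mu s, forall y, G y = 0} -> {ae mu #|v|, forall t : #|v|.-tuple R, avg G t = 0}.
Proof.
move=> mG G0; have mEG : measurable_fun setT (EFin \o G) by exact/measurable_EFinP.
have iG : (mu s).-integrable setT (EFin \o G).
  apply: (@ae_eq_integrable _ _ _ _ (cst 0%E)) => //; last exact: integrable0.
  by apply: filterS G0 => y /= ->.
have nG : (\int[mu s]_y `|G y|%:E = 0)%E.
  rewrite (ae_eq_integral (cst 0%E)) ?integral0//.
    by apply/measurable_EFinP; exact: measurableT_comp.
  by apply: filterS G0 => y /= ->; rewrite normr0.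
have := integral_norm_avg_le v iG; rewrite nG => le0.
have mavg : measurable_fun setT (EFin \o @avg R s v G).
  by apply/measurable_EFinP; exact: measurable_avg.
have /(ae_eq_integral_abs (mu #|v|) measurableT mavg) :
    (\int[mu #|v|]_t `|(avg G t)%:E| = 0)%E.
  by apply/eqP; rewrite eq_le le0/=; exact: integral_ge0.
by apply: filterS => t /(_ I) [].
Qed.

(** With [sigma t = t - 1] the ANOVA factor becomes the anchored one, so the transform of [d]
    vanishes. The transform at [v] is [d v] plus terms from proper supersets of [v], which allows
    solving from the largest sets downwards. *)
Lemma anova_coef_eq0 W (d : @coef_family R s) :
  (forall u v, u \subset v -> v \in W -> u \in W) ->
  (forall u, u \in W -> (mu #|u|).-integrable setT (EFin \o d u)) ->
  (forall x, cube x ->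
    \sum_(u in W) \int[mu #|u|]_t (d u t * anova_kernel x t) = 0) ->
  forall u, u \in W -> {ae mu #|u|, forall t, d u t = 0}.
Proof.
move=> Wdown id d0; pose sigma (t : R) := t - 1.
have bsigma : unit_bounded sigma.
  split; first exact: measurable_funB.
  by move=> t /andP[t0 t1]; rewrite ler_norml; apply/andP; split; rewrite /sigma; lra.
have k'E z : (fun t => anova1 z t - sigma t) = anchored1 z.
  by apply/funext => t; rewrite /anova1 /anchored1 /sigma; ring.
have Td0 v : v \in W -> {ae mu #|v|, forall t, transform sigma W d v t = 0}.
  move: v; apply: anchored_coef_eq0 => // [u uW|x cx]; first exact: integrable_transform.
  have := d0 x cx; rewrite (@transform_sum _ _ sigma anova1)//.
  - move=> {2}<-; apply: eq_bigr => v vW; apply: eq_Rintegral => t _; congr (_ * _).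
    by apply: eq_bigr => j _; rewrite /sigma /anova1; ring.
  - by move=> z _; exact: anova1_bounded.
  - by move=> z _; rewrite k'E; exact: anchored1_bounded.
(* Descending induction on the size of [v], phrased through a bound on [s - #|v|]. *)
suff H m v : (s - #|v| < m)%N -> v \in W -> {ae mu #|v|, forall t, d v t = 0}.
  by move=> u uW; apply: (H (s - #|u|).+1).
elim: m v => // m ih v vm vW.
have rest0 : {ae mu #|v|, forall t, \sum_(u in W | (v \subset u) && (u != v))
    avg (fun y => d u (restr u y) * \prod_(j in u :\: v) sigma (tnth y j)) t = 0}.
  apply: ae_sum0 => u /and3P[uW vu uv].
  have /measurable_EFinP mterm :=
    measurable_int _ (integrable_transform_term v bsigma (id u uW)).
  apply: ae_avg_eq0; first exact: mterm.
  have : {ae mu #|u|, forall t, d u t = 0}.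
    apply: ih => //; rewrite -ltnS (leq_trans _ vm)// ltnS ltn_sub2l//.
      rewrite (leq_trans (proper_card (_ : v \proper u)))//.
        by rewrite finset.properEneq eq_sym uv.
      by rewrite (leq_trans (max_card _))// card_ord.
    by apply: proper_card; rewrite finset.properEneq eq_sym uv.
  move=> /(ae_image (fun A mA => @cube_measure_restr R s u A mA)).
  by apply: filterS => y /= ->; rewrite mul0r.
apply: filterS2 (Td0 v vW) rest0 => t; rewrite /transform.
rewrite (bigD1 v) /=; last by rewrite vW subxx.
move=> + r0; rewrite [X in _ + X](_ : _ = 0) ?addr0; last first.
  by rewrite -[RHS]r0; apply: eq_bigl => u; rewrite -andbA.
(* For [u = v] the product over [u :\: v] is empty and averaging returns [d v]. *)
rewrite (_ : (fun y => _) = (fun y => d v (restr v y))) ?avg_restr//.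
by apply/funext => y; rewrite finset.setDv big_set0 mulr1.
Qed.

End coef_uniqueness.

(** * Norm estimates *)

Section Lnorm_extra.
Context d (T : measurableType d) (R : realType) (mu : {measure set T -> \bar R}).
Implicit Types (f g : T -> R) (p : \bar R).

(** The real number that enters [coef_norm]. An infinite norm would be read as 0, so estimates of it
    come with membership in [Lfun]. *)
Definition rnorm p f : R := fine ('N[mu]_p[EFin \o f])%E.

Lemma in_LfunP p f :
  f \in Lfun mu p <-> measurable_fun setT f /\ ('N[mu]_p[EFin \o f] < +oo)%E.
Proof.
split; first by rewrite inE => /andP[]; rewrite !inE.
by move=> [mf nf]; rewrite inE; apply/andP; rewrite !inE.
Qed.

Lemma Lfun_EFin_rnorm p f : f \in Lfun mu p ->
  ('N[mu]_p[EFin \o f] = (rnorm p f)%:E)%E.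
Proof.
move=> /in_LfunP[_ fp]; rewrite fineK// ge0_fin_numE//; exact: Lnorm_ge0.
Qed.

Lemma rnorm_ge0 p f : 0 <= rnorm p f.
Proof. by rewrite fine_ge0// Lnorm_ge0. Qed.

Lemma rnorm_le p f C : measurable_fun setT f ->
  ('N[mu]_p[EFin \o f] <= C%:E)%E -> f \in Lfun mu p /\ rnorm p f <= C.
Proof.
move=> mf fC; have fp : f \in Lfun mu p.
  by apply/in_LfunP; split => //; rewrite (le_lt_trans fC)// ltry.
by split => //; rewrite -lee_fin -Lfun_EFin_rnorm.
Qed.

(** Minkowski's inequality; membership and estimate go through one induction because each step uses
    the finiteness of the norm of the partial sum. *)
Lemma rnorm_sum_le p (I : Type) (r : seq I) (P : pred I) (F : I -> T -> R) :
  (1 <= p)%E -> (forall i, P i -> F i \in Lfun mu p) ->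
  (fun t => \sum_(i <- r | P i) F i t) \in Lfun mu p /\
  rnorm p (fun t => \sum_(i <- r | P i) F i t) <= \sum_(i <- r | P i) rnorm p (F i).
Proof.
move=> p1 Fp.
have p0 : p != 0%E by rewrite gt_eqF// (lt_le_trans _ p1).
elim: r => [|i r [ihL ih]].
  rewrite big_nil (_ : (fun _ => _) = cst 0); last by apply/funext=> t; rewrite big_nil.
  by apply: rnorm_le => //; rewrite (Lnorm0 mu p0).
rewrite big_cons; case: (boolP (P i)) => Pi; last first.
  rewrite (_ : (fun _ => _) = fun t => \sum_(i <- r | P i) F i t)//.
  by apply/funext => t; rewrite big_cons (negbTE Pi).
rewrite (_ : (fun _ => _) = F i \+ (fun t => \sum_(i <- r | P i) F i t)); last first.
  by apply/funext => t; rewrite big_cons Pi.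
have [mF _] := (in_LfunP _ _).1 (Fp i Pi); have [mS _] := (in_LfunP _ _).1 ihL.
apply: rnorm_le; first exact: measurable_funD.
rewrite (le_trans (eminkowski _ mF mS p1))//.
by rewrite (Lfun_EFin_rnorm (Fp i Pi)) (Lfun_EFin_rnorm ihL) -EFinD lee_fin lerD2l.
Qed.

Lemma Lnorm_ae_eq p f g : p = 1%E \/ p = +oo%E ->
  measurable_fun setT f -> measurable_fun setT g ->
  {ae mu, forall t, f t = g t} ->
  ('N[mu]_p[EFin \o f] = 'N[mu]_p[EFin \o g])%E.
Proof.
move=> [->|->] mf mg fg.
  rewrite !Lnorm1; apply: ae_eq_integral => //.
  - by apply/measurable_EFinP; exact: measurableT_comp.
  - by apply/measurable_EFinP; exact: measurableT_comp.
  - by apply: filterS fg => t /= ->.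
rewrite unlock; case: ifPn => // _; apply: eq_ess_sup.
by apply: filterS fg => t /= ->.
Qed.

End Lnorm_extra.

Section Lnorm_probability.
Context d (T : measurableType d) (R : realType) (mu : probability T R).
Implicit Types (f g : T -> R) (p : \bar R).

Lemma Lnorm_oo f : ('N[mu]_+oo[EFin \o f] = ess_sup mu (abse \o (EFin \o f)))%E.
Proof.
have mu0 : (0 < mu setT)%E by rewrite probability_setT lte01.
by rewrite unlock; case: ifPn => // /negP[]; exact: mu0.
Qed.

Lemma Lfun_Lfun1 p f : (1 <= p)%E -> f \in Lfun mu p ->
  mu.-integrable setT (EFin \o f).
Proof.
move=> p1 fp; apply/Lfun1_integrable; apply: (Lfun_subset _ p1 _ p1 fp) => //.
by rewrite fin_num_measure.
Qed.

Lemma Lnorm_oo_le f C : (forall t, `|f t| <= C) -> ('N[mu]_+oo[EFin \o f] <= C%:E)%E.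
Proof.
by move=> fC; rewrite Lnorm_oo; apply/ess_supP; apply: nearW => t; rewrite /= lee_fin.
Qed.

(* A pointwise bound survives the partial integrations of [avg] without a
   Fubini theorem for null sets. *)
Lemma Lfun_oo_clamp f : f \in Lfun mu +oo%E -> exists g : T -> R,
  [/\ measurable_fun setT g, {ae mu, forall t, f t = g t} &
      forall t, `|g t| <= rnorm mu +oo f].
Proof.
move=> fp; have [mf _] := (in_LfunP _ _ _).1 fp; set C := rnorm mu +oo f.
have C0 : 0 <= C by exact: rnorm_ge0.
exists (fun t => Num.max (- C) (Num.min C (f t))); split.
- by apply: measurable_maxr => //; exact: measurable_minr.
- have := ess_sup_ge mu (abse \o (EFin \o f)).
  rewrite -Lnorm_oo (Lfun_EFin_rnorm fp) -/C.
  apply: filterS => t; rewrite /= lee_fin ler_norml => /andP[? ?].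
  by rewrite min_r// max_r.
- move=> t; rewrite ler_norml le_max lexx /= ge_max ge_min lexx /= andbT.
  by rewrite (le_trans _ C0)// oppr_le0.
Qed.

End Lnorm_probability.

Lemma eq_weighted_norm (R : realType) (I : finType) (p : \bar R) (U : {set I})
    (w a b : I -> R) :
  (forall u, u \in U -> a u = b u) -> weighted_norm p U w a = weighted_norm p U w b.
Proof.
move=> ab; rewrite /weighted_norm; case: p => [r| |]; last by [].
  by congr (_ `^ _); apply: eq_bigr => u uU; rewrite ab.
by apply: eq_bigr => u uU; rewrite ab.
Qed.

Section function_norms.
Context {R : realType} {s : nat}.
Implicit Types (u v : {set 'I_s}) (gamma : {set 'I_s} -> R) (p : \bar R).
Local Notation mu := (@cube_measure R).

Lemma p_ge1 p : p = 1%E \/ p = +oo%E -> (1 <= p)%E.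
Proof. by move=> [->|->]; rewrite ?leey. Qed.

(** The difference of the two families represents the zero function, so [zero] makes them agree
    almost everywhere, and the norms ignore null sets. *)
Lemma coef_norm_unique (k : R -> R -> R) p gamma (h h' : @coef_family R s) f :
  p = 1%E \/ p = +oo%E ->
  (forall z, unit_bounded (k z)) ->
  (forall d : @coef_family R s,
    (forall u, u \in active gamma -> (mu #|u|).-integrable setT (EFin \o d u)) ->
    (forall x, cube x ->
      \sum_(u in active gamma) \int[mu #|u|]_t (d u t * prod_kernel k x t) = 0) ->
    forall u, u \in active gamma -> {ae mu #|u|, forall t, d u t = 0}) ->
  decomposes (prod_kernel k) p gamma h f ->
  decomposes (prod_kernel k) p gamma h' f ->
  coef_norm p gamma h = coef_norm p gamma h'.
Proof.
move=> hp bk zero [hL hf] [h'L h'f]; apply: eq_weighted_norm => u uW.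
have iL (g : @coef_family R s) :
    (forall u, u \in active gamma -> g u \in Lfun (mu #|u|) p) ->
    forall u, u \in active gamma -> (mu #|u|).-integrable setT (EFin \o g u).
  move=> gL v vW; apply: (@Lfun_Lfun1 _ _ _ _ p); [exact: p_ge1|exact: gL].
have iK (g : @coef_family R s) :
    (forall u, u \in active gamma -> g u \in Lfun (mu #|u|) p) ->
    forall x v, cube x -> v \in active gamma ->
    (mu #|v|).-integrable setT (EFin \o (fun t => g v t * prod_kernel k x t)).
  move=> gL x v cx vW; apply: (@integrable_mul_prod _ _ (g v) predT
    (fun i => k (tnth x (@enum_val _ (mem v) i)))) => //; exact: iL.
have ihh' : {ae mu #|u|, forall t, h u t - h' u t = 0}.
  apply: (zero (fun u t => h u t - h' u t)) => // [v vW|x cx].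
    apply: (@integrableB _ _ _ _ _ measurableT (EFin \o h v) (EFin \o h' v)) => //.
      exact: iL.
    exact: iL.
  transitivity (\sum_(v in active gamma) (\int[mu #|v|]_t (h v t * prod_kernel k x t) -
      \int[mu #|v|]_t (h' v t * prod_kernel k x t))).
    apply: eq_bigr => v vW; rewrite -RintegralB//; [|exact: iK|exact: iK].
    by apply: eq_Rintegral => t _; rewrite mulrBl.
  by rewrite sumrB -hf// -h'f// subrr.
rewrite (@Lnorm_ae_eq _ _ _ _ _ (h u) (h' u) hp)//.
- by have [] := (in_LfunP _ _ _).1 (hL u uW).
- by have [] := (in_LfunP _ _ _).1 (h'L u uW).
- by apply: filterS ihh' => t /eqP; rewrite subr_eq0 => /eqP.
Qed.

Definition down_closed gamma :=
  forall u v, u \subset v -> v \in active gamma -> u \in active gamma.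

(** By uniqueness the set inside [fnorm] is a singleton, so the choice made by [xget] returns the
    norm of whichever decomposition is at hand. *)
Lemma anchored_normE p gamma h f : p = 1%E \/ p = +oo%E -> down_closed gamma ->
  decomposes (@anchored_kernel R s) p gamma h f ->
  anchored_norm p gamma f = (coef_norm p gamma h)%:E.
Proof.
move=> hp gd hf; apply: xget_unique; first by exists h.
move=> _ [h' h'f <-]; congr EFin.
apply: (coef_norm_unique (k := anchored1) hp _ _ h'f hf).
  exact: anchored1_bounded.
by move=> d; exact: anchored_coef_eq0.
Qed.

Lemma anova_normE p gamma h f : p = 1%E \/ p = +oo%E -> down_closed gamma ->
  decomposes (@anova_kernel R s) p gamma h f ->
  anova_norm p gamma f = (coef_norm p gamma h)%:E.
Proof.
move=> hp gd hf; apply: xget_unique; first by exists h.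
move=> _ [h' h'f <-]; congr EFin.
apply: (coef_norm_unique (k := anova1) hp _ _ h'f hf).
  exact: anova1_bounded.
by move=> d; exact: anova_coef_eq0.
Qed.

Lemma anova_of_anchored p gamma h f : p = 1%E \/ p = +oo%E -> down_closed gamma ->
  decomposes (@anchored_kernel R s) p gamma h f ->
  (forall v, v \in active gamma ->
    transform (fun t => 1 - t) (active gamma) h v \in Lfun (mu #|v|) p) ->
  decomposes (@anova_kernel R s) p gamma
    (transform (fun t => 1 - t) (active gamma) h) f.
Proof.
move=> hp gd [hL hf] gL; split => // x cx; rewrite hf//.
apply: (@transform_sum _ _ _ anchored1) => //.
- exact: onem_bounded.
- by move=> z _; exact: anchored1_bounded.
- by move=> z _; exact: anova1_bounded.
- by move=> u uW; apply: (@Lfun_Lfun1 _ _ _ _ p); [exact: p_ge1|exact: hL].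
Qed.

End function_norms.

(** * Norms of the partial integrals *)

Section term_norms.
Context {R : realType} {s : nat}.
Implicit Types (u v : {set 'I_s}).
Local Notation mu := (@cube_measure R).
Local Notation U := (uniform_prob (@ltr01 R)).

(** Coordinates outside [A] carry the constant 1, which integrates to 1 against a probability
    measure. *)
Lemma ge0_integral_prod_in n (A : {set 'I_n}) (phi : R -> R) (a : R) :
  measurable_fun setT phi -> (forall t, 0 <= phi t) ->
  (\int[U]_t (phi t)%:E = a%:E)%E ->
  (\int[mu n]_y (\prod_(j in A) phi (tnth y j))%:E = (a ^+ #|A|)%:E)%E.
Proof.
move=> mphi phi0 phia.
have := @ge0_integral_cube_measure_prod R n
  (fun j => if j \in A then phi else cst 1) _ _.
under eq_integral.
  move=> y _.
  rewrite (eq_bigr (fun j => if j \in A then phi (tnth y j) else 1)); last first.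
    by move=> j _; case: ifP.
  rewrite -big_mkcond; over.
move=> ->; first last.
- by move=> i x; case: ifP.
- by move=> i; case: ifP.
rewrite (eq_bigr (fun j => if j \in A then a%:E else 1%E)); last first.
  move=> j _; case: ifP => // _.
  rewrite [LHS](@integral_cst _ _ _ U setT measurableT 1%E) mul1e.
  exact: probability_setT.
by rewrite -big_mkcond /= prodEFin prodr_const.
Qed.

(** This is the value of [m_const] at 1, the factor contributed by each integrated coordinate for
    infinite [p]. *)
Lemma integral_onem : (\int[U]_t `|1 - t|%:E = (2^-1)%:E)%E.
Proof.
have mF : measurable_fun setT (fun t : R => `|1 - t|).
  by apply: measurableT_comp => //; exact: measurable_funB.
rewrite integral_uniform//; last exact/measurable_EFinP.
rewrite subr0 invr1 mul1e.
transitivity (\int[@lebesgue_measure R]_(t in `[0%R, 1%R]) (1 - t)%R%:E)%E.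
  apply: eq_integral => t; rewrite inE /= in_itv /= => /andP[_ t1].
  by rewrite ger0_norm// subr_ge0.
pose F (t : R) := t - 2^-1 * t ^+ 2.
have dF (x : R) : is_derive x 1 F (1 - x).
  by apply: is_derive_eq; rewrite /GRing.scale /=; field.
have cF (x : R) : {for x, continuous F}.
  by apply: differentiable_continuous; apply/derivable1_diffP; have [] := dF x.
rewrite (@continuous_FTC2 _ (fun t => 1 - t) F) //.
- by rewrite -EFinB /F; congr EFin; field.
- by apply: continuous_subspaceT => x; apply: cvgB; [exact: cvg_cst|exact: cvg_id].
- split.
  + by move=> x _; have [] := dF x.
  + by apply: cvg_at_right_filter; exact: cF.
  + by apply: cvg_at_left_filter; exact: cF.
- by move=> x _; rewrite derive1E; exact: derive_val.
Qed.

(** The factors [1 - t_j] are at most 1 on the cube, and averaging contracts L_1. *)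
Lemma rnorm_term_1 u v (h : #|u|.-tuple R -> R) : h \in Lfun (mu #|u|) 1 ->
  let g : #|v|.-tuple R -> R :=
    avg (fun y => h (restr u y) * \prod_(j in u :\: v) (1 - tnth y j)) in
  g \in Lfun (mu #|v|) 1 /\ rnorm (mu #|v|) 1 g <= rnorm (mu #|u|) 1 h.
Proof.
move=> hL g; have ih : (mu #|u|).-integrable setT (EFin \o h).
  by apply/Lfun1_integrable.
have iterm := integrable_transform_term v (@onem_bounded R) ih.
apply: rnorm_le; first exact: measurable_avg.
rewrite -Lfun_EFin_rnorm// !Lnorm1.
apply: le_trans (integral_norm_avg_le v iterm) _.
have mh : measurable_fun setT (abse \o (EFin \o h)).
  by apply: measurableT_comp => //; exact: measurable_int ih.
rewrite [leRHS](@ge0_integral_image _ _ _ _ _ _ _ (restr u)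
  (fun A mA => @cube_measure_restr R s u A mA) (abse \o (EFin \o h)))//; last first.
  by move=> t; exact: abse_ge0.
apply: ae_ge0_le_integral => //.
- have /measurable_EFinP mt := measurable_int _ iterm.
  by apply/measurable_EFinP; apply: measurableT_comp mt.
- by move=> y _; exact: abse_ge0.
- exact: (measurableT_comp mh (@measurable_restr R s u)).
- apply: filterS (ae_cube s) => y cy _; rewrite /= lee_fin normrM ler_piMr//.
  apply: (@prod_tnth_le1 _ _ (mem (u :\: v)) (fun _ t => 1 - t)) => // i _.
  exact: onem_bounded.
Qed.

(** The pointwise bound [C] leaves the integral, and each remaining factor [1 - t_j] integrates to
    1/2. A bound valid everywhere applies on every slice at fixed [t]. *)
Lemma rnorm_term_oo u v (h : #|u|.-tuple R -> R) (C : R) :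
  measurable_fun setT h -> (forall t, `|h t| <= C) ->
  let g : #|v|.-tuple R -> R :=
    avg (fun y => h (restr u y) * \prod_(j in u :\: v) (1 - tnth y j)) in
  g \in Lfun (mu #|v|) +oo /\ rnorm (mu #|v|) +oo g <= C * 2^-1 ^+ #|u :\: v|.
Proof.
move=> mh hC g.
have C0 : 0 <= C by apply: le_trans (hC [tuple 0 | i < #|u|]).
have ih : (mu #|u|).-integrable setT (EFin \o h).
  have i1 : (mu #|u|).-integrable setT (EFin \o cst 1%R).
    exact: finite_measure_integrable_cst.
  rewrite (_ : EFin \o h = EFin \o (fun t => cst 1 t * h t)); last first.
    by apply/funext => t /=; rewrite mul1r.
  exact: integrable_mul_bounded i1 mh (fun y _ => hC y).
have iterm := integrable_transform_term v (@onem_bounded R) ih.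
apply: rnorm_le; first exact: measurable_avg.
apply: Lnorm_oo_le => t.
pose P (y : s.-tuple R) : R := \prod_(j in u :\: v) (1 - tnth y j).
have mP : measurable_fun setT P.
  apply: (@measurable_prod_tnth _ _ (mem (u :\: v)) (fun _ t => 1 - t)) => i _.
  by have [] := @onem_bounded R.
pose hm y := h (restr u (merge (t, y))).
have mhm : measurable_fun setT hm.
  apply: (measurableT_comp mh); apply: (measurableT_comp (@measurable_restr R s u)).
  by apply: (measurableT_comp (@measurable_merge R s v)); exact: pair1_measurable.
have i1 : (mu s).-integrable setT (EFin \o cst 1%R).
  exact: finite_measure_integrable_cst.
have iP : (mu s).-integrable setT (EFin \o P).
  rewrite (_ : EFin \o P = EFin \o (fun t => cst 1 t * P t)); last first.
    by apply/funext => y /=; rewrite mul1r.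
  apply: (integrable_mul_bounded (C := 1) i1 mP) => y cy.
  apply: (@prod_tnth_le1 _ _ (mem (u :\: v)) (fun _ t => 1 - t)) => // i _.
  exact: onem_bounded.
have iPh : (mu s).-integrable setT (EFin \o (fun y => P y * hm y)).
  exact: integrable_mul_bounded iP mhm (fun y _ => hC _).
have gE : g t = \int[mu s]_y (P y * hm y).
  apply: eq_Rintegral => y _; rewrite mulrC; congr (_ * _).
  by apply: eq_bigr => j; rewrite inE => /andP[jv _]; rewrite tnth_merge_out.
rewrite gE; apply: le_trans (le_normr_Rintegral measurableT iPh) _.
have iCP : (mu s).-integrable setT (EFin \o (fun y => `|P y|)).
  exact: integrable_norm.
rewrite -[X in _ <= _ * X](_ : \int[mu s]_y `|P y| = _); last first.
  rewrite /Rintegral -[RHS]/(fine (2^-1 ^+ #|u :\: v|)%:E); congr fine.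
  rewrite -(@ge0_integral_prod_in s (u :\: v) (fun t => `|1 - t|))//.
  - by apply: eq_integral => y _; rewrite normr_prod.
  - by apply: measurableT_comp => //; have [] := @onem_bounded R.
  - exact: integral_onem.
rewrite -RintegralZl//; apply: le_Rintegral => //.
- exact: integrable_norm.
- exact: (integrableZl measurableT C iCP).
- by move=> y _; rewrite normrM mulrC ler_wpM2r//; exact: hC.
Qed.

End term_norms.

(** * The embedding norm *)

Section weighted_norm_theory.
Context {R : realType} {I : finType} (W : {set I}) (p : \bar R).
Hypothesis hp : p = 1%E \/ p = +oo%E.
Implicit Types w a b : I -> R.

Lemma weighted_norm1E w a : (forall u, u \in W -> 0 < w u) ->
  (forall u, u \in W -> 0 <= a u) ->
  weighted_norm 1%E W w a = \sum_(u in W) (w u)^-1 * a u.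
Proof.
move=> w0 a0; rewrite /weighted_norm invr1 powRr1.
  apply: eq_bigr => u uW; rewrite powR_inv1 ?powRr1//; first exact: a0.
  by rewrite ltW// w0.
by apply: sumr_ge0 => u uW; rewrite mulr_ge0// powR_ge0.
Qed.

Lemma weighted_norm_ge0 w a : 0 <= weighted_norm p W w a.
Proof.
by case: hp => ->; rewrite /weighted_norm ?powR_ge0//; exact: bigmax_ge_id.
Qed.

Lemma le_weighted_norm w a b : (forall u, u \in W -> 0 < w u) ->
  (forall u, u \in W -> 0 <= a u <= b u) ->
  weighted_norm p W w a <= weighted_norm p W w b.
Proof.
move=> w0 ab; have [-> |->] := hp.
  rewrite !weighted_norm1E//.
  - apply: ler_sum => u uW; have /andP[_ abu] := ab u uW.
    by rewrite ler_pM2l// invr_gt0 w0.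
  - by move=> u uW; have /andP[a0 abu] := ab u uW; exact: le_trans abu.
  - by move=> u /ab /andP[].
rewrite /weighted_norm; apply: le_bigmax2 => u uW; have /andP[_ abu] := ab u uW.
by rewrite ler_pM2l// invr_gt0 w0.
Qed.

Lemma weighted_normZ w a (k : R) : (forall u, u \in W -> 0 < w u) ->
  (forall u, u \in W -> 0 <= a u) -> 0 <= k ->
  weighted_norm p W w (fun u => k * a u) = k * weighted_norm p W w a.
Proof.
move=> w0 a0 k0; have [-> |->] := hp.
  rewrite !weighted_norm1E//; last by move=> u uW; rewrite mulr_ge0// a0.
  by rewrite mulr_sumr; apply: eq_bigr => u uW; rewrite mulrCA.
rewrite /weighted_norm; elim/big_ind2 : _ => [|x x' y y' -> ->|u uW].
- by rewrite mulr0.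
- by rewrite maxr_pMr.
- by rewrite mulrCA.
Qed.

(** For [w = gamma] this is the substitution that turns the norm of a coefficient family into the
    denominator of the ratio. *)
Lemma weighted_norm_unit w a : (forall u, u \in W -> 0 < w u) ->
  (forall u, u \in W -> 0 <= a u) ->
  weighted_norm p W w a = weighted_norm p W (fun=> 1) (fun u => (w u)^-1 * a u).
Proof.
move=> w0 a0; have [-> |->] := hp.
  rewrite !weighted_norm1E//.
    by apply: eq_bigr => u uW; rewrite invr1 mul1r.
  by move=> u uW; rewrite mulr_ge0 ?a0// invr_ge0 ltW// w0.
by rewrite /weighted_norm; apply: eq_bigr => u uW; rewrite invr1 mul1r.
Qed.

Lemma weighted_norm_gt0 a u : (forall u, u \in W -> 0 <= a u) -> u \in W ->
  a u <> 0 -> 0 < weighted_norm p W (fun=> 1) a.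
Proof.
move=> a0 uW /eqP au; have au0 : 0 < a u by rewrite lt0r au a0.
have [-> |->] := hp.
  rewrite weighted_norm1E//; under eq_bigr do rewrite invr1 mul1r.
  rewrite (bigD1 u)//= ltr_pwDl//.
  by apply: sumr_ge0 => v /andP[vW _]; exact: a0.
rewrite /weighted_norm (lt_le_trans au0)//.
by rewrite (bigD1 u)//= le_max invr1 mul1r lexx.
Qed.

End weighted_norm_theory.

(** Reindexing by [u = v :|: w], with inverse [w = u :\: v]. *)
Lemma sum_supersets (R : nmodType) (I : finType) (W : {set {set I}}) (v : {set I})
    (F : {set I} -> {set I} -> R) :
  \sum_(w : {set I} | (w \subset ~: v) && (v :|: w \in W)) F (v :|: w) w =
  \sum_(u in W | v \subset u) F u (u :\: v).
Proof.
have vK (w : {set I}) : w \subset ~: v -> (v :|: w) :\: v = w.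
  move=> wv; rewrite finset.setDUl finset.setDv finset.set0U.
  by apply/finset.setDidPl; rewrite finset.disjoints_subset.
rewrite [RHS](reindex_onto (fun w => v :|: w) (fun u => u :\: v)) /=; last first.
  by move=> u /andP[_ vu]; rewrite -{1}(finset.setIidPr vu) finset.setID.
apply: eq_big => [w|w /andP[wv _]]; last by rewrite vK.
rewrite finset.subsetUl andbT andbC; congr (_ && _).
apply/idP/eqP => [/vK //|<-]; by rewrite finset.setDE finset.subsetIr.
Qed.

Lemma rnormZ d (T : measurableType d) (R : realType)
    (mu : {measure set T -> \bar R}) (p : \bar R) (f : T -> R) (C : R) :
  (1 <= p)%E -> f \in Lfun mu p ->
  (fun t => C * f t) \in Lfun mu p /\
  rnorm mu p (fun t => C * f t) = `|C| * rnorm mu p f.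
Proof.
move=> p1 fp; have [mf _] := (in_LfunP _ _ _).1 fp.
have E : ('N[mu]_p[EFin \o (fun t => C * f t)%R] = `|C|%:E * (rnorm mu p f)%:E)%E.
  by rewrite -(Lfun_EFin_rnorm fp); exact: (LnormZ (Lfun_Sub p1 fp) C).
have [|L _] := @rnorm_le _ _ _ mu p (fun t => C * f t) (`|C| * rnorm mu p f)
    (measurable_funM (measurable_cst C) mf); first by rewrite E EFinM.
by split => //; rewrite {1}/rnorm E.
Qed.

(** * Test functions for the lower bound *)

Section bump.
Context {R : realType}.
Local Notation mu := (@cube_measure R).
Local Notation U := (uniform_prob (@ltr01 R)).
Variable a : R.
Hypotheses (a0 : 0 < a) (a1 : a <= 1).

(** The uniform density on [0,a). For small [a] its mass sits where [1 - t] is close to 1; for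
    [a = 1] it is 1 almost everywhere on the unit interval. *)
Definition bump (t : R) : R := a^-1 * \1_(`[0, a[%classic) t.

Lemma bump_ge0 t : 0 <= bump t.
Proof. by rewrite mulr_ge0// ?invr_ge0 ?ltW// indicE. Qed.

Lemma measurable_bump : measurable_fun setT bump.
Proof. by apply: measurable_funM => //; exact: measurable_indic. Qed.

Lemma integral_bump : (\int[U]_t (bump t)%:E = 1)%E.
Proof.
under eq_integral do rewrite EFinM.
rewrite ge0_integralZl//; last 2 first.
- by apply/measurable_EFinP; exact: measurable_indic.
- by rewrite lee_fin invr_ge0 ltW.
rewrite integral_indic// setIT [X in (_ * X)%E]uniform_prob01E// setIidl.
  rewrite lebesgue_measure_itv/= lte_fin a0 oppr0 adde0 -EFinM mulVf//.
  by rewrite gt_eqF.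
by apply: subset_itvl; rewrite bnd_simp.
Qed.

Lemma bump_onem_ge0 t : 0 <= bump t * (1 - t).
Proof.
rewrite /bump indicE; case: (boolP (t \in _)) => [|_]; last by rewrite mulr0 mul0r.
rewrite inE /= in_itv /= => /andP[_ ta].
by rewrite !mulr_ge0// ?invr_ge0 ?ltW// subr_gt0 (lt_le_trans ta).
Qed.

Lemma measurable_bump_onem : measurable_fun setT (fun t => bump t * (1 - t)).
Proof.
apply: measurable_funM; first exact: measurable_bump.
exact: measurable_funB.
Qed.

(** The factor that integrating out one coordinate of a test function produces, in place of
    [m_const]. *)
Definition bump_onem : R := fine (\int[U]_t (bump t * (1 - t))%:E)%E.

Lemma integral_bump_onem :
  (\int[U]_t (bump t * (1 - t))%:E = bump_onem%:E)%E /\ 1 - a <= bump_onem.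
Proof.
(* Finiteness comes first, so that taking [fine] in [bump_onem] loses nothing. *)
have le1 : (\int[U]_t (bump t * (1 - t))%:E <= 1)%E.
  rewrite -integral_bump; apply: ge0_le_integral => //.
  - by move=> t _; rewrite lee_fin; exact: bump_onem_ge0.
  - by apply/measurable_EFinP; exact: measurable_bump_onem.
  - by apply/measurable_EFinP; exact: measurable_bump.
  - move=> t _; rewrite lee_fin /bump indicE; case: (boolP (t \in _)) => [|_].
      rewrite inE /= in_itv /= => /andP[t0 _].
      by apply: ler_piMr; [rewrite mulr_ge0// invr_ge0 ltW|lra].
    by rewrite mulr0 mul0r.
have E : (\int[U]_t (bump t * (1 - t))%:E = bump_onem%:E)%E.
  rewrite fineK// ge0_fin_numE ?(le_lt_trans le1) ?ltry//.
  by apply: integral_ge0 => t _; rewrite lee_fin; exact: bump_onem_ge0.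
split => //; rewrite -lee_fin -E -[leLHS]mule1 -integral_bump.
rewrite -ge0_integralZl//; last 3 first.
- by apply/measurable_EFinP; exact: measurable_bump.
- by move=> t _; rewrite lee_fin bump_ge0.
- by rewrite lee_fin subr_ge0.
apply: ge0_le_integral => //.
- by move=> t _; rewrite lee_fin mulr_ge0 ?subr_ge0// bump_ge0.
- by apply/measurable_EFinP; apply: measurable_funM => //; exact: measurable_bump.
- by apply/measurable_EFinP; exact: measurable_bump_onem.
- move=> t _; rewrite -EFinM lee_fin mulrC /bump indicE; case: (boolP (t \in _)) => [|_].
    rewrite inE /= in_itv /= => /andP[t0 ta].
    by apply: ler_wpM2l; [rewrite mulr_ge0// invr_ge0 ltW|lra].
  by rewrite mulr0 !mul0r.
Qed.

Lemma rnorm_bump_1 n :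
  (fun t : n.-tuple R => \prod_i bump (tnth t i)) \in Lfun (mu n) 1 /\
  rnorm (mu n) 1 (fun t => \prod_i bump (tnth t i)) = 1.
Proof.
have mP : measurable_fun setT (fun t : n.-tuple R => \prod_i bump (tnth t i)).
  by apply: (@measurable_prod_tnth _ _ predT (fun=> bump)) => i _; exact: measurable_bump.
have E : ('N[mu n]_1[EFin \o (fun t : n.-tuple R => \prod_i bump (tnth t i))%R] = 1)%E.
  rewrite Lnorm1.
  have := @ge0_integral_cube_measure_prod R n (fun=> bump)
    (fun=> measurable_bump) (fun=> bump_ge0).
  rewrite big1 => [<-|i _]; last exact: integral_bump.
  apply: eq_integral => t _; rewrite /= ger0_norm// prodr_ge0// => i _; exact: bump_ge0.
have [|L _] := @rnorm_le _ _ _ (mu n) 1%E _ 1 mP; first by rewrite E.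
by split => //; rewrite /rnorm E.
Qed.

End bump.

Section bump1.
Context {R : realType}.
Local Notation mu := (@cube_measure R).
Local Notation U := (uniform_prob (@ltr01 R)).

Lemma rnorm_bump_oo n :
  (fun t : n.-tuple R => \prod_i bump 1 (tnth t i)) \in Lfun (mu n) +oo /\
  rnorm (mu n) +oo (fun t => \prod_i bump 1 (tnth t i)) = 1.
Proof.
have mP : measurable_fun setT (fun t : n.-tuple R => \prod_i bump 1 (tnth t i)).
  by apply: (@measurable_prod_tnth _ _ predT (fun=> bump 1)) => i _; exact: measurable_bump.
have E : ('N[mu n]_+oo[EFin \o (fun t : n.-tuple R => \prod_i bump 1 (tnth t i))%R] = 1)%E.
  have mu0 : (0 < mu n setT)%E by rewrite probability_setT lte01.
  rewrite Lnorm_oo; apply: ess_sup_ae_cst; first exact: mu0.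
  apply: filterS (ae_cube_measure n) => t ht /=; rewrite big1 ?normr1// => i _.
  by rewrite /bump invr1 mul1r indicE mem_set//= in_itv /= ht.
have [|L _] := @rnorm_le _ _ _ (mu n) +oo%E _ 1 mP; first by rewrite E.
by split => //; rewrite /rnorm E.
Qed.

Lemma bump_onem1 : bump_onem 1 = 2^-1 :> R.
Proof.
rewrite /bump_onem -[RHS]/(fine (2^-1)%:E); congr fine; rewrite -integral_onem.
rewrite [LHS]integral_uniform//; last 2 first.
- by apply/measurable_EFinP; apply: measurable_bump_onem.
- by move=> t; rewrite lee_fin; apply: bump_onem_ge0.
rewrite [RHS]integral_uniform//; last first.
  by apply/measurable_EFinP; apply: measurableT_comp => //; exact: measurable_funB.
congr (_ * _)%E; apply: eq_integral => t; rewrite inE /= in_itv /= => /andP[t0 t1].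
congr EFin; rewrite /bump invr1 mul1r indicE.
(* At [t = 1] the indicator of [0,1) is 0, but so is [1 - t]. *)
have [->|t1'] := eqVneq t 1; first by rewrite subrr normr0 mulr0.
by rewrite mem_set ?mul1r ?ger0_norm ?subr_ge0//= in_itv /= t0 lt_neqAle t1'.
Qed.

End bump1.

(** * Upper bound for the embedding norm *)

Section embedding.
Context {R : realType} {s : nat}.
Implicit Types (u v : {set 'I_s}) (f : s.-tuple R -> R) (c : {set 'I_s} -> R).
Local Notation mu := (@cube_measure R).
Variables (p q : \bar R) (gamma : {set 'I_s} -> R).
Hypothesis hpq : (p = 1%E /\ q = +oo%E) \/ (p = +oo%E /\ q = 1%E).
Hypothesis gd : down_closed gamma.
Local Notation W := (active gamma).
Local Notation onem := (fun t : R => 1 - t).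

Let hp : p = 1%E \/ p = +oo%E. Proof. by case: hpq => -[->]; [left|right]. Qed.
Let p1 : (1 <= p)%E. Proof. exact: p_ge1. Qed.

Lemma m_constE : m_const q = if p == 1%E then 1 else 2^-1.
Proof.
case: hpq => -[-> ->]; first by rewrite eqxx.
by rewrite /= invr1 powRr1 ?addr_ge0.
Qed.

Lemma active_gt0 u : u \in W -> 0 < gamma u.
Proof. by rewrite inE. Qed.

Lemma rnorm_term u v (h : #|u|.-tuple R -> R) :
  h \in Lfun (mu #|u|) p ->
  (p = +oo%E -> forall t, `|h t| <= rnorm (mu #|u|) p h) ->
  let g : #|v|.-tuple R -> R :=
    avg (fun y => h (restr u y) * \prod_(j in u :\: v) (1 - tnth y j)) in
  g \in Lfun (mu #|v|) p /\
  rnorm (mu #|v|) p g <= rnorm (mu #|u|) p h * m_const q ^+ #|u :\: v|.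
Proof.
rewrite m_constE => hL hb g; case: hp => pE.
  rewrite pE eqxx expr1n mulr1; apply: rnorm_term_1; by rewrite -pE.
rewrite pE /= -pE; rewrite {1 2}pE; apply: rnorm_term_oo; last exact: hb.
by have [] := (in_LfunP _ _ _).1 hL.
Qed.

(** The transform is applied to a modification of [h] on null sets, which has the same norms and
    represents the same [f]; Minkowski then sums the bounds on the terms. *)
Lemma anova_decomposition_le h f :
  decomposes (@anchored_kernel R s) p gamma h f ->
  exists2 g, decomposes (@anova_kernel R s) p gamma g f &
    forall v, v \in W -> rnorm (mu #|v|) p (g v) <=
      \sum_(u in W | v \subset u) rnorm (mu #|u|) p (h u) * m_const q ^+ #|u :\: v|.
Proof.
move=> [hL hf].
(* For [p = 1] the coefficient is kept; for infinite [p] it is clamped at its norm, so that the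
   essential bound holds everywhere. *)
have /(_ _)/cid-/all_sig[h' hh'] u : exists g : #|u|.-tuple R -> R, u \in W ->
    [/\ measurable_fun setT g, {ae mu #|u|, forall t, h u t = g t} &
        p = +oo%E -> forall t, `|g t| <= rnorm (mu #|u|) p (h u)].
  have [uW|uW] := boolP (u \in W); last by exists (h u).
  case: hpq => -[pE _].
    exists (h u) => _; split => //.
    - by have [] := (in_LfunP _ _ _).1 (hL u uW).
    - exact: nearW.
    - by rewrite pE.
  have huL : h u \in Lfun (mu #|u|) +oo by rewrite -pE; exact: hL.
  have [g [mg ag bg]] := Lfun_oo_clamp huL.
  by exists g => _; split => // _; rewrite pE.
have nE u : u \in W ->
    ('N[mu #|u|]_p[EFin \o h' u] = 'N[mu #|u|]_p[EFin \o h u])%E.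
  move=> uW; have [mg ag _] := hh' u uW; apply/esym/Lnorm_ae_eq => //.
  by have [] := (in_LfunP _ _ _).1 (hL u uW).
have h'L u : u \in W -> h' u \in Lfun (mu #|u|) p.
  move=> uW; have [mg _ _] := hh' u uW; apply/in_LfunP; split => //.
  by rewrite nE//; have [] := (in_LfunP _ _ _).1 (hL u uW).
have h'f : decomposes (@anchored_kernel R s) p gamma h' f.
  split => // x cx; rewrite hf//; apply: eq_bigr => u uW.
  have [mg ag _] := hh' u uW; have [mh _] := (in_LfunP _ _ _).1 (hL u uW).
  have mK : measurable_fun setT (@anchored_kernel R s u x).
    apply: (@measurable_prod_tnth _ _ predT
      (fun i => anchored1 (tnth x (@enum_val _ (mem u) i)))).
    by move=> i _; have [] := @anchored1_bounded R (tnth x (enum_val i)).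
  rewrite /Rintegral; congr fine; apply: ae_eq_integral => //.
  - by apply/measurable_EFinP; exact: measurable_funM.
  - by apply/measurable_EFinP; exact: measurable_funM.
  - by apply: filterS ag => t /= ->.
have terms u v : u \in W -> v \in W ->
    let g : #|v|.-tuple R -> R :=
      avg (fun y => h' u (restr u y) * \prod_(j in u :\: v) (1 - tnth y j)) in
    g \in Lfun (mu #|v|) p /\
    rnorm (mu #|v|) p g <= rnorm (mu #|u|) p (h u) * m_const q ^+ #|u :\: v|.
  move=> uW vW g; rewrite -[X in _ <= X * _](_ : rnorm (mu #|u|) p (h' u) = _).
    apply: rnorm_term; first exact: h'L.
    have [_ _ b] := hh' u uW => pE t; rewrite /rnorm nE//; exact: b.
  by rewrite /rnorm nE.
have tnorm v : v \in W -> transform onem W h' v \in Lfun (mu #|v|) p /\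
    rnorm (mu #|v|) p (transform onem W h' v) <= \sum_(u in W | v \subset u)
      rnorm (mu #|u|) p (h u) * m_const q ^+ #|u :\: v|.
  move=> vW; have [|tL tle] := @rnorm_sum_le _ _ _ (mu #|v|) p _ (index_enum _)
    (fun u => (u \in W) && (v \subset u))
    (fun u => avg (fun y => h' u (restr u y) * \prod_(j in u :\: v) (1 - tnth y j))) p1.
    by move=> u /andP[uW _]; have [] := terms u v uW vW.
  split; first exact: tL.
  apply: le_trans tle _; apply: ler_sum => u /andP[uW _].
  by have [] := terms u v uW vW.
exists (transform onem W h'); last by move=> v /tnorm[].
by apply: anova_of_anchored => // v /tnorm[].
Qed.

(** The inner sum of the ratio, indexed by the supersets [u] of [v]; [m] is a parameter so that
    [bump_onem] can stand in for [m_const]. *)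
Definition weighted_sums (m : R) c v : R :=
  \sum_(u in W | v \subset u) c u * gamma u * m ^+ #|u :\: v|.

Lemma lower_bound_ratioE c : lower_bound_ratio p q gamma c =
  weighted_norm p W gamma (weighted_sums (m_const q) c) / weighted_norm p W (fun=> 1) c.
Proof.
congr (_ / _); apply: eq_weighted_norm => v _.
exact: (sum_supersets W v (fun u w => c u * gamma u * m_const q ^+ #|w|)).
Qed.

Lemma m_const_ge0 : 0 <= m_const q.
Proof. by rewrite m_constE; case: ifP. Qed.

Lemma anova_norm_le h f : decomposes (@anchored_kernel R s) p gamma h f ->
  let c u := (gamma u)^-1 * rnorm (mu #|u|) p (h u) in
  (anova_norm p gamma f <=
    (weighted_norm p W gamma (weighted_sums (m_const q) c))%:E)%E /\
  coef_norm p gamma h = weighted_norm p W (fun=> 1) c.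
Proof.
move=> hf c; split.
  have [g gf gle] := anova_decomposition_le hf.
  rewrite (anova_normE hp gd gf) lee_fin; apply: le_weighted_norm => //.
    exact: active_gt0.
  move=> v vW; rewrite rnorm_ge0 /=; apply: le_trans (gle v vW) _.
  apply: ler_sum => u /andP[uW _].
  by rewrite /c [_ * gamma u]mulrAC mulVf ?mul1r// gt_eqF// active_gt0.
apply: weighted_norm_unit => //; first exact: active_gt0.
by move=> u _; exact: rnorm_ge0.
Qed.

End embedding.

(** * Lower bound from products of bumps *)

Section sharpness.
Context {R : realType} {s : nat}.
Implicit Types (u v : {set 'I_s}) (f : s.-tuple R -> R) (c : {set 'I_s} -> R).
Local Notation mu := (@cube_measure R).
Variables (p : \bar R) (gamma : {set 'I_s} -> R) (a : R).
Hypothesis hp : p = 1%E \/ p = +oo%E.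
Hypothesis gd : down_closed gamma.
Hypotheses (a0 : 0 < a) (a1 : a <= 1).
Local Notation W := (active gamma).
Local Notation onem := (fun t : R => 1 - t).
Local Notation B := (fun t => \prod_i bump a (tnth t i)).
Hypothesis rnormB : forall n, (B : n.-tuple R -> R) \in Lfun (mu n) p /\
  rnorm (mu n) p (B : n.-tuple R -> R) = 1.

(** The product over [u] splits: the factors in [v] depend on [t] only and stay outside, while each
    factor in [u :\: v] meets its [1 - t_j] and integrates to [bump_onem a]. *)
Lemma avg_bump u v (C : R) (t : #|v|.-tuple R) : v \subset u ->
  avg (fun y => C * B (restr u y) * \prod_(j in u :\: v) (1 - tnth y j)) t =
  C * bump_onem a ^+ #|u :\: v| * B t.
Proof.
move=> vu; pose P (y : s.-tuple R) : R :=
  \prod_(j in u :\: v) (bump a (tnth y j) * (1 - tnth y j)).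
have [mE _] := integral_bump_onem a0 a1.
have P0 y : 0 <= P y by apply: prodr_ge0 => j _; exact: bump_onem_ge0.
have mP : measurable_fun setT P.
  apply: (@measurable_prod_tnth _ _ (mem (u :\: v)) (fun _ t => bump a t * (1 - t))).
  by move=> j _; exact: measurable_bump_onem.
have intP : (\int[mu s]_y (P y)%:E = (bump_onem a ^+ #|u :\: v|)%:E)%E.
  apply: (@ge0_integral_prod_in _ s (u :\: v) (fun t => bump a t * (1 - t))) => //.
    exact: measurable_bump_onem.
  exact: bump_onem_ge0.
have iP : (mu s).-integrable setT (EFin \o P).
  apply/integrableP; split; first exact/measurable_EFinP.
  under eq_integral do rewrite /= ger0_norm//.
  by rewrite intP ltry.
transitivity (\int[mu s]_y (C * B t * P y)).
  apply: eq_Rintegral => y _.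
  have -> : B (restr u (merge (t, y))) =
      \prod_(j in u) bump a (tnth (merge (t, y)) j).
    by rewrite [RHS]big_enum_val; apply: eq_bigr => i _; rewrite tnth_restr.
  rewrite (big_setID v) /= (finset.setIidPr vu) -!mulrA; congr (_ * _).
  rewrite -big_split /=; congr (_ * _).
    by rewrite [LHS]big_enum_val; apply: eq_bigr => i _; rewrite tnth_merge_in.
  by apply: eq_bigr => j; rewrite inE => /andP[jv _]; rewrite tnth_merge_out.
by rewrite RintegralZl// /Rintegral intP /= mulrAC.
Qed.

(** The test function with coefficients [C u] times a product of bumps has anchored norm 1, and its
    ANOVA coefficients are multiples of products of bumps, so its ANOVA norm is the left-hand side
    exactly. *)
Lemma weighted_sums_bump_le c : (forall u, u \in W -> 0 <= c u) ->
  0 < weighted_norm p W (fun=> 1) c ->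
  ((weighted_norm p W gamma (weighted_sums gamma (bump_onem a) c) /
    weighted_norm p W (fun=> 1) c)%:E <= embedding_norm p gamma)%E.
Proof.
move=> c0; set N := weighted_norm p W (fun=> 1) c => N0.
have p1 := p_ge1 hp; have g0 u : u \in W -> 0 < gamma u by rewrite inE.
have m0 : 0 <= bump_onem a.
  by apply: fine_ge0; apply: integral_ge0 => t _; rewrite lee_fin; exact: bump_onem_ge0.
(* Division by [N] normalises the anchored norm to 1. *)
pose C u := N^-1 * (c u * gamma u).
have cg0 u : u \in W -> 0 <= c u * gamma u.
  by move=> uW; apply: mulr_ge0; [exact: c0|exact/ltW/g0].
have iN0 : 0 <= N^-1 by rewrite invr_ge0 ltW.
have C0 u : u \in W -> 0 <= C u by move=> uW; apply: mulr_ge0 => //; exact: cg0.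
pose h : @coef_family R s := fun u t => C u * B t.
pose f x := \sum_(u in W) \int[mu #|u|]_t (h u t * anchored_kernel x t).
have hf : decomposes (@anchored_kernel R s) p gamma h f.
  by split => // u _; have [BL _] := rnormB #|u|; have [] := rnormZ (C u) p1 BL.
pose D v := \sum_(u in W | v \subset u) C u * bump_onem a ^+ #|u :\: v|.
have DE v : D v = N^-1 * weighted_sums gamma (bump_onem a) c v.
  by rewrite mulr_sumr; apply: eq_bigr => u _; rewrite mulrA.
have D0 v : 0 <= D v.
  by apply: sumr_ge0 => u /andP[uW _]; rewrite mulr_ge0 ?exprn_ge0// C0.
have gE v : transform onem W h v = fun t => D v * B t.
  apply/funext => t; rewrite /transform mulr_suml; apply: eq_bigr => u /andP[uW vu].
  exact: avg_bump.
have gf : decomposes (@anova_kernel R s) p gamma (transform onem W h) f.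
  apply: anova_of_anchored => // v _; rewrite gE.
  by have [BL _] := rnormB #|v|; have [] := rnormZ (D v) p1 BL.
have hN : coef_norm p gamma h = 1.
  rewrite /coef_norm (@eq_weighted_norm _ _ _ _ _ _ C); last first.
    move=> u uW; have [BL BN] := rnormB #|u|; have [_] := rnormZ (C u) p1 BL.
    by rewrite BN mulr1 ger0_norm ?C0.
  rewrite weighted_norm_unit// (@eq_weighted_norm _ _ _ _ _ _ (fun u => N^-1 * c u)).
    by rewrite weighted_normZ// mulVf// gt_eqF.
  move=> u uW; rewrite /C mulrCA [c u * _]mulrC [X in _ * X = _]mulrA.
  by rewrite mulVf ?mul1r// gt_eqF// g0.
have gN : coef_norm p gamma (transform onem W h) =
    weighted_norm p W gamma (weighted_sums gamma (bump_onem a) c) / N.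
  rewrite /coef_norm (@eq_weighted_norm _ _ _ _ _ _
    (fun v => N^-1 * weighted_sums gamma (bump_onem a) c v)); last first.
    move=> v vW; rewrite gE -DE; have [BL BN] := rnormB #|v|.
    by have [_] := rnormZ (D v) p1 BL; rewrite BN mulr1 ger0_norm.
  rewrite weighted_normZ//; first by rewrite mulrC.
  move=> v _; apply: sumr_ge0 => u /andP[uW _].
  by rewrite mulr_ge0 ?exprn_ge0// cg0.
rewrite -gN -(anova_normE hp gd gf); apply: ereal_sup_ubound; exists f => //.
split; first by exists h.
by rewrite (anchored_normE hp gd hf) hN.
Qed.

End sharpness.

(** * Equality of the supremum and the embedding norm *)

Lemma bernoulli_onem (R : realDomainType) (a : R) n : 0 <= a <= 1 ->
  1 - n%:R * a <= (1 - a) ^+ n.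
Proof.
move=> /andP[a0 a1]; elim: n => [|n ih]; first by rewrite mul0r subr0.
rewrite exprS; apply: (@le_trans _ _ ((1 - a) * (1 - n%:R * a))).
  (* The two sides differ by [n a^2], which is nonnegative. *)
  rewrite -natr1; have := mulr_ge0 (ler0n R n) (mulr_ge0 a0 a0); nra.
by rewrite ler_wpM2l// subr_ge0.
Qed.

Theorem proposition2 (R : realType) (s : nat) (p pstar : \bar R)
    (gamma : {set 'I_s} -> R)
    (hp : p = 1%E \/ p = +oo%E)
    (hpstar : (p^-1 + pstar^-1 = 1)%E)
    (gamma_ge0 : forall u, 0 <= gamma u)
    (gamma_neq0 : exists u, gamma u <> 0)
    (gamma_closed : forall u w : {set 'I_s},
       u \subset w -> 0 < gamma w -> 0 < gamma u) :
  ereal_sup [set (lower_bound_ratio p pstar gamma c)%:E | c in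
    [set c : {set 'I_s} -> R |
      (forall u, u \in active gamma -> 0 <= c u) /\
      (exists2 u, u \in active gamma & c u <> 0)]]
  = embedding_norm p gamma.
Proof.
have gd : down_closed gamma.
  by move=> u v uv; rewrite !inE; exact: gamma_closed.
have hpq : (p = 1%E /\ pstar = +oo%E) \/ (p = +oo%E /\ pstar = 1%E).
  have pNy : (-oo < p)%E by case: hp => ->; rewrite ?ltNyr ?ltNyy.
  have p0 : p != 0%E by case: hp => ->; rewrite ?onee_neq0.
  have {}hpstar := (hoelder_conjugateP pstar pNy p0).1 hpstar.
  case: hp hpstar => ->; rewrite ?hoelder_conjugate1 ?hoelder_conjugatey => ->.
    by left.
  by right.
have g0 u : u \in active gamma -> 0 < gamma u by rewrite inE.
have [u0 u0W] : exists u, u \in active gamma.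
  by case: gamma_neq0 => u /eqP gu; exists u; rewrite inE lt0r gu gamma_ge0.
have m0 := m_const_ge0 hpq.
have ws0 m c v : 0 <= m -> (forall u, u \in active gamma -> 0 <= c u) ->
    0 <= weighted_sums gamma m c v.
  move=> hm c0; apply: sumr_ge0 => u /andP[uW _].
  by rewrite !mulr_ge0 ?exprn_ge0 ?c0// ltW// g0.
set S := (X in ereal_sup X).
(* This covers functions whose coefficients all have norm 0, which yield no admissible [c]. *)
have S0 : (0 <= ereal_sup S)%E.
  apply: (@le_trans _ _ (lower_bound_ratio p pstar gamma (fun=> 1))%:E).
    by rewrite lee_fin (lower_bound_ratioE p) divr_ge0// weighted_norm_ge0.
  apply: ereal_sup_ubound; exists (fun=> 1) => //; split => //.
  by exists u0 => //; apply/eqP; exact: oner_neq0.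
apply/eqP; rewrite eq_le; apply/andP; split; last first.
  apply: ge_ereal_sup => _ [f [[h hf] fle1] <-].
  have [fle cN] := anova_norm_le hpq gd hf.
  move: fle1; rewrite (anchored_normE hp gd hf) lee_fin cN => c1.
  set c := (fun u => _ * _) in fle c1.
  have c0 u : u \in active gamma -> 0 <= c u.
    by move=> uW; rewrite /c mulr_ge0 ?rnorm_ge0// invr_ge0 ltW// g0.
  apply: (le_trans fle).
  have [[u uW cu]|/forall2NP call] := pselect (exists2 u, u \in active gamma & c u <> 0).
    have N0 := weighted_norm_gt0 hp c0 uW cu.
    apply: (@le_trans _ _ (lower_bound_ratio p pstar gamma c)%:E).
      (* The norm of [c] is at most 1, so dividing by it does not decrease the value. *)
      rewrite lee_fin (lower_bound_ratioE p) ler_pdivlMr//.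
      by rewrite ler_piMr// weighted_norm_ge0.
    by apply: ereal_sup_ubound; exists c => //; split => //; exists u.
  (* Zero is written as [0 * 0] so that homogeneity evaluates the norm to 0. *)
  rewrite (@eq_weighted_norm _ _ _ _ _ _ (fun=> 0 * 0)).
    by rewrite weighted_normZ// mul0r.
  move=> v vW; rewrite mul0r /weighted_sums big1// => u /andP[uW _].
  by have [//|/contrapT ->] := call u; rewrite !mul0r.
apply: ge_ereal_sup => _ [c [c0 [u uW cu]] <-].
have N0 := weighted_norm_gt0 hp c0 uW cu.
rewrite (lower_bound_ratioE p); set r := _ / _.
have r0 : 0 <= r by rewrite divr_ge0// ?weighted_norm_ge0// ltW.
have [[pE qE]|[pE qE]] := hpq; last first.
  (* For infinite [p] the bump with [a = 1] gives the constant 1/2 exactly, and no limit is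
     taken. *)
  have -> : r = weighted_norm p (active gamma) gamma
      (weighted_sums gamma (bump_onem 1) c) / weighted_norm p (active gamma) (fun=> 1) c.
    by rewrite bump_onem1 /r (m_constE hpq) pE.
  apply: weighted_sums_bump_le => // n; rewrite pE; exact: rnorm_bump_oo.
(* For [p = 1] each integrated coordinate costs a factor of at least [1 - a], and there are at most
   [s] of them. *)
have lower a : 0 < a -> a <= 1 -> ((((1 - a) ^+ s) * r)%:E <= embedding_norm p gamma)%E.
  move=> a0 a1; apply: (@le_trans _ _
    (weighted_norm p (active gamma) gamma (weighted_sums gamma (bump_onem a) c) /
     weighted_norm p (active gamma) (fun=> 1) c)%:E); last first.
    apply: weighted_sums_bump_le => // n; rewrite pE; exact: rnorm_bump_1.
  rewrite lee_fin /r mulrA ler_wpM2r ?invr_ge0 ?(ltW N0)//.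
  rewrite -weighted_normZ ?exprn_ge0 ?subr_ge0//; last by move=> v _; exact: ws0.
  apply: le_weighted_norm => // v vW.
  rewrite mulr_ge0 ?exprn_ge0 ?subr_ge0 ?ws0//=.
  rewrite mulr_sumr; apply: ler_sum => w /andP[wW vw].
  rewrite (m_constE hpq) pE eqxx expr1n mulr1 mulrC ler_wpM2l//.
    by rewrite mulr_ge0 ?c0// ltW// g0.
  have [_ ma] := integral_bump_onem a0 a1.
  apply: (@le_trans _ _ ((1 - a) ^+ #|w :\: v|)).
    apply: ler_wiXn2l; [by rewrite subr_ge0|by rewrite gerBl ltW|].
    by rewrite (leq_trans (max_card _))// card_ord.
  by rewrite lerXn2r ?nnegrE ?subr_ge0// (le_trans _ ma)// subr_ge0.
apply/lee_addgt0Pr => e e0.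
(* By Bernoulli's inequality the loss is at most [s a r], which this choice keeps below [e]; the
   summand 1 keeps the denominator positive when [s] or [r] is 0. *)
pose a := Num.min 1 (e / (s%:R * r + 1)).
have d0 : 0 < s%:R * r + 1 by rewrite ltr_pwDr// mulr_ge0.
have a0 : 0 < a by rewrite lt_min ltr01 divr_gt0.
have a1 : a <= 1 by rewrite ge_min lexx.
have ae : a * (s%:R * r + 1) <= e by rewrite -ler_pdivlMr// ge_min lexx orbT.
apply: (@le_trans _ _ (((1 - a) ^+ s * r)%:E + e%:E)%E); last first.
  by rewrite leeD2r// lower.
rewrite -EFinD lee_fin.
have := @bernoulli_onem R a s; rewrite (ltW a0) a1 => /(_ isT) b.
have := ler_wpM2r r0 b; nra.
Qed.
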